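(* Let $W_{\boldsymbol\lambda}\in \boldsymbol B(\ell^2)$ be a CPD unilateral weighted shift with the scalar representing triplet $(\mathfrak b,\mathfrak c,\nu)$ satisfying the following conditions: (i) $\vartheta :=\sup\operatorname{supp}\nu > 1$, (ii) $\int_{(1,\vartheta]}\frac{1}{(x-1)^2}\,\mathrm d \nu(x) < \infty$, (iii) $\nu(\{\vartheta\}) > 0$. Then $W_{\boldsymbol\lambda}$ is of type III and is similar to a subnormal unilateral weighted shift. Moreover, if at least one of the following conditions holds: (a) $1 - \int_{(1,\vartheta]}\frac{1}{(x-1)^2}\,\mathrm d \nu(x) < \int_{[0,1)} \frac{1}{(x-1)^2}\,\mathrm d \nu(x) \leqslant \infty$, (b) $\mathfrak b \neq \int_{\mathbb R_+} \frac{1}{x-1}\,\mathrm d \nu(x)$, (c) $\mathfrak c > 0$, then $W_{\boldsymbol\lambda}$ is not subnormal.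
   Context: $\mathbb Z_+=\{0,1,2,\dots\}$, $\mathbb R_+=[0,\infty)$; $\boldsymbol B(\mathcal H,\mathcal K)$ denotes bounded linear operators between complex Hilbert spaces, $\boldsymbol B(\mathcal H)=\boldsymbol B(\mathcal H,\mathcal H)$; $\{e_n\}_{n=0}^\infty$ is the standard orthonormal basis of $\ell^2=\ell^2(\mathbb Z_+)$. Unilateral weighted shift: for a bounded sequence $\boldsymbol\lambda=\{\lambda_n\}_{n=0}^\infty\subseteq(0,\infty)$, $W_{\boldsymbol\lambda}\in\boldsymbol B(\ell^2)$ is the operator with $W_{\boldsymbol\lambda}e_n=\lambda_n e_{n+1}$, $n\in\mathbb Z_+$. Put $\hat\lambda_0=1$ and $\hat\lambda_n=\lambda_0^2\cdots\lambda_{n-1}^2$ for $n\geqslant1$. CPD: $T\in\boldsymbol B(\mathcal H)$ is conditionally positive definite (CPD) if for every $h\in\mathcal H$ the sequence $\gamma_n=\|T^nh\|^2$ satisfies $\sum_{i,j=0}^k\gamma_{i+j}\alpha_i\bar\alpha_j\geqslant0$ for all finite complex sequences $\alpha_0,\dots,\alpha_k$ with $\sum_{j=0}^k\alpha_j=0$. Scalar representing triplet: let $Q_0=Q_1=0$ and $Q_n(x)=\sum_{j=0}^{n-2}(n-j-1)x^j$ for $n\geqslant2$. It is known that $W_{\boldsymbol\lambda}$ is CPD if and only if there are $\mathfrak b\in\mathbb R$, $\mathfrak c\in\mathbb R_+$ and a compactly supported finite positive Borel measure $\nu$ on $\mathbb R_+$ with $\nu(\{1\})=0$ such that $\hat\lambda_n=1+\mathfrak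 bn+\mathfrak cn^2+\int_{\mathbb R_+}Q_n\,\mathrm d\nu$ for all $n\in\mathbb Z_+$; the triplet $(\mathfrak b,\mathfrak c,\nu)$ is then unique and is called the scalar representing triplet of $W_{\boldsymbol\lambda}$. Types: a CPD unilateral weighted shift with scalar representing triplet $(\mathfrak b,\mathfrak c,\nu)$ is of type I if $\nu=0$ and $\mathfrak c=0$; of type II if $\operatorname{supp}\nu=\{0\}$ and $\mathfrak c=0$; of type III if $\operatorname{supp}\nu\nsubseteq\{0\}$ or $\mathfrak c\neq0$. Operators $A\in\boldsymbol B(\mathcal H)$, $B\in\boldsymbol B(\mathcal K)$ are similar if $YA=BY$ for some bijective $Y\in\boldsymbol B(\mathcal H,\mathcal K)$. Under (i) and (ii), $\int_{(1,\vartheta]}\frac1{x-1}\,\mathrm d\nu(x)<\infty$, so the integral $\int_{\mathbb R_+}\frac1{x-1}\,\mathrm d\nu(x)$ in (b) exists as an element of $[-\infty,\infty)$. *)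

(* Defs.v *)
From HB Require Import structures.
From mathcomp Require Import all_boot all_order all_algebra.
From mathcomp Require Import sesquilinear complex ring lra.
From mathcomp Require Import all_classical all_reals all_analysis.

Set Implicit Arguments.
Unset Strict Implicit.
Unset Printing Implicit Defensive.

Import Order.TTheory GRing.Theory Num.Theory.
Import numFieldNormedType.Exports.
Import ComplexField.Normc.

Local Open Scope classical_set_scope.
Local Open Scope ring_scope.
Local Open Scope complex_scope.

Section form_norm.
Variables (R : realType) (H : lmodType R[i]) (form : H -> H -> R[i]).

(* [form x x] is a nonnegative real for a dot product, so [Re] loses nothing. *)
Definition form_norm (x : H) : R := Num.sqrt (complex.Re (form x x)).

Definition form_complete : Prop := forall u : nat -> H,
  (forall e : R, 0 < e -> \forall m & n \near \oo, form_norm (u m - u n) < e) ->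
  exists l : H, form_norm (u n - l) @[n --> \oo] --> (0 : R).

End form_norm.

HB.mixin Record Lmodule_isHilbert (R : realType) H of GRing.Lmodule R[i] H := {
  hdot : {dot H for Num.conj} ;
  hdot_complete : form_complete hdot
}.

#[short(type="hilbertType")]
HB.structure Definition Hilbert (R : realType) :=
  { H of GRing.Lmodule R[i] H & Lmodule_isHilbert R H }.

Notation hnorm := (form_norm hdot).

Section complex_series.
Variable R : realType.
Implicit Types f g : nat -> R[i].

Definition complex_series_sum f : R[i] :=
  limn (series (@complex.Re R \o f)) +i* limn (series (@complex.Im R \o f)).

Let csummable f :=
  cvgn (series (@complex.Re R \o f)) /\ cvgn (series (@complex.Im R \o f)).

Fact csumP (a : R[i]) f g : csummable f -> csummable g ->
  complex_series_sum (fun n => a * f n + g n) =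
  a * complex_series_sum f + complex_series_sum g.
Proof.
case: a => a b [cf cf'] [cg cg'].
have E1 : @complex.Re R \o (fun n => (a +i* b) * f n + g n) =
  (a *: (@complex.Re R \o f) - b *: (@complex.Im R \o f)) + (@complex.Re R \o g).
  by apply/funext => n /=; rewrite !fctE/=; case: (f n) (g n) => ? ? [? ?].
have E2 : @complex.Im R \o (fun n => (a +i* b) * f n + g n) =
  (a *: (@complex.Im R \o f) + b *: (@complex.Re R \o f)) + (@complex.Im R \o g).
  by apply/funext => n /=; rewrite !fctE/=; case: (f n) (g n) => ? ? [? ?].
have cZ k (u : nat -> R) : cvgn (series u) -> cvgn (series (k *: u)).
  exact: is_cvg_seriesZ.
rewrite /complex_series_sum E1 E2.
rewrite lim_seriesD//; last by apply: is_cvg_seriesB; exact: cZ.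
rewrite lim_seriesB; [|exact: cZ..].
rewrite lim_seriesD//; last by apply: is_cvg_seriesD; exact: cZ.
rewrite lim_seriesD; [|exact: cZ..].
by rewrite !lim_seriesZ.
Qed.

Fact csumC f : csummable f ->
  complex_series_sum (fun n => Num.conj (f n)) = Num.conj (complex_series_sum f).
Proof.
move=> [cf cf']; rewrite /complex_series_sum.
have -> : @complex.Re R \o (fun n => Num.conj (f n)) = @complex.Re R \o f.
  by apply/funext => n /=; case: (f n).
have -> : @complex.Im R \o (fun n => Num.conj (f n)) = - (@complex.Im R \o f).
  by apply/funext => n /=; rewrite !fctE/=; case: (f n).
by rewrite lim_seriesN.
Qed.

End complex_series.

Section l2.
Variable R : realType.
Implicit Types x y : nat -> R[i].

Definition square_summable : {pred nat -> R[i]} :=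
  fun x => `[< cvgn (series (fun n => normc (x n) ^+ 2)) >].

Fact normc_sqrE (z : R[i]) :
  normc z ^+ 2 = complex.Re z ^+ 2 + complex.Im z ^+ 2.
Proof. by case: z => a b /=; rewrite sqr_sqrtr// addr_ge0// sqr_ge0. Qed.

Fact normc_sqrD (z w : R[i]) :
  normc (z + w) ^+ 2 <= 2 * (normc z ^+ 2 + normc w ^+ 2).
Proof.
rewrite !normc_sqrE; case: z w => [a b] [c d] /=.
have := sqr_ge0 (a - c); have := sqr_ge0 (b - d).
by rewrite !expr2; nra.
Qed.

Fact square_summable_submod : submod_closed square_summable.
Proof.
split=> [|a x y /asboolP cx /asboolP cy]; apply/asboolP.
  rewrite (_ : (fun _ => _) = (fun=> 0)); last first.
    by apply/funext => n; rewrite normc0 expr0n.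
  apply: (@is_cvg_near_cst _ _ (0 : R)).
  by near=> n; rewrite /series/= big1.
apply: (@series_le_cvg _ _ (2 *: ((normc a ^+ 2 *: (fun n => normc (x n) ^+ 2))
                        + (fun n => normc (y n) ^+ 2)))).
- by move=> n; exact: sqr_ge0.
- move=> n; rewrite /= mulr_ge0// addr_ge0 ?sqr_ge0//.
  by rewrite mulr_ge0// sqr_ge0.
- move=> n; apply: (le_trans (normc_sqrD _ _)).
  by rewrite normcM exprMn.
- apply: is_cvg_seriesZ; apply: is_cvg_seriesD => //.
  exact: is_cvg_seriesZ.
Unshelve. all: by end_near. Qed.

HB.instance Definition _ :=
  GRing.isSubmodClosed.Build R[i] _ square_summable square_summable_submod.

Record l2 : Type := L2 {
  l2_seq :> nat -> R[i] ;
  l2_square_summable : l2_seq \in square_summable }.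

HB.instance Definition _ := [isSub of l2 for l2_seq].
HB.instance Definition _ := [Choice of l2 by <:].
HB.instance Definition _ := [SubChoice_isSubLmodule of l2 by <:].

Definition l2_dot (x y : l2) : R[i] :=
  complex_series_sum (fun n => x n * Num.conj (y n)).

Fact l2_cvg (x : l2) : cvgn (series (fun n => normc (x n) ^+ 2)).
Proof. by have /asboolP := l2_square_summable x. Qed.

Fact l2_dot_cvg (x y : l2) :
  cvgn (series (@complex.Re R \o (fun n => x n * Num.conj (y n)))) /\
  cvgn (series (@complex.Im R \o (fun n => x n * Num.conj (y n)))).
Proof.
have cxy : cvgn (series ((fun n => normc (x n) ^+ 2) + (fun n => normc (y n) ^+ 2))).
  by apply: is_cvg_seriesD; exact: l2_cvg.
have H (u : nat -> R) :
    (forall n, `|u n| <= normc (x n) ^+ 2 + normc (y n) ^+ 2) -> cvgn (series u).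
  move=> hu; apply: normed_cvg; apply: series_le_cvg cxy => n //=.
  by rewrite addr_ge0// sqr_ge0.
split; apply: H => n; rewrite !normc_sqrE /=; case: (x n) (y n) => [a b] [c d] /=;
  rewrite ler_norml; apply/andP; split;
  have := (sqr_ge0 (a - c), sqr_ge0 (a + c), sqr_ge0 (b - d), sqr_ge0 (b + d));
  move=> [[[]]]; have := (sqr_ge0 (a - d), sqr_ge0 (a + d), sqr_ge0 (b - c), sqr_ge0 (b + c));
  move=> [[[]]]; rewrite !expr2; lra.
Qed.

Fact l2_dotDl (a : R[i]) (x y z : l2) :
  l2_dot (a *: x + y) z = a * l2_dot x z + l2_dot y z.
Proof.
rewrite /l2_dot -csumP; [|exact: l2_dot_cvg..].
by congr complex_series_sum; apply/funext => n; rewrite /= mulrDl mulrA.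
Qed.

Fact l2_dotC (x y : l2) : l2_dot x y = Num.conj (l2_dot y x).
Proof.
rewrite /l2_dot -csumC; last exact: l2_dot_cvg.
congr complex_series_sum; apply/funext => n.
by rewrite rmorphM /= conjCK mulrC.
Qed.

Fact l2_dot_bilinear :
  bilinear_for (GRing.Scale.Law.clone R[i] _ *%R _)
    (GRing.Scale.Law.clone R[i] _ (Num.conj \; *%R) _) l2_dot.
Proof.
split => [z a x y|z a x y]; first exact: l2_dotDl.
by rewrite l2_dotC l2_dotDl rmorphD rmorphM /= -!l2_dotC.
Qed.

HB.instance Definition _ :=
  bilinear_isBilinear.Build R[i] l2 l2 R[i] _ _ l2_dot l2_dot_bilinear.

Fact l2_dot_hermitian (x y : l2) :
  l2_dot x y = (-1) ^+ false * Num.conj (l2_dot y x).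
Proof. by rewrite expr0 mul1r l2_dotC. Qed.

HB.instance Definition _ :=
  isHermitianSesquilinear.Build R[i] l2 false Num.conj l2_dot l2_dot_hermitian.

Fact l2_dotE (x : l2) :
  l2_dot x x = (limn (series (fun n => normc (x n) ^+ 2)))%:C.
Proof.
rewrite /l2_dot /complex_series_sum; congr (_ +i* _).
  congr (limn (series _)); apply/funext => n /=; rewrite normc_sqrE.
  by case: (x n) => a b /=; rewrite mulrN opprK !expr2.
rewrite (_ : _ \o _ = fun=> 0); last first.
  by apply/funext => n /=; case: (x n) => a b /=; rewrite mulrN mulrC addNr.
apply: lim_near_cst => //.
by near=> n; rewrite /series/= big1.
Unshelve. all: by end_near. Qed.

Fact l2_partial_le (x : l2) n :
  series (fun n => normc (x n) ^+ 2) n <= limn (series (fun n => normc (x n) ^+ 2)).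
Proof.
apply: nondecreasing_cvgn_le; last exact: l2_cvg.
by apply: nondecreasing_series => k _ _; exact: sqr_ge0.
Qed.

Fact l2_dot_gt0 (x : l2) : x != 0 -> 0 < l2_dot x x.
Proof.
move=> x0; rewrite l2_dotE ltcR.
have [n xn0] : exists n, x n != 0.
  apply/not_existsP => x0'; move/negP: x0; apply; apply/eqP/val_inj.
  by apply/funext => n; apply/eqP; move/negP: (x0' n); rewrite negbK.
apply: lt_le_trans (l2_partial_le x n.+1).
rewrite /series/= big_nat_recr//= ltr_wpDl ?sumr_ge0//.
  by move=> *; exact: sqr_ge0.
rewrite exprn_gt0// lt_neqAle eq_sym; apply/andP; split.
  by apply: contra xn0 => /eqP/eq0_normc ->.
by case: (x n) => a b; exact: sqrtr_ge0.
Qed.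

HB.instance Definition _ := isDotProduct.Build R[i] l2 l2_dot l2_dot_gt0.

Fact l2_normE (x : l2) :
  form_norm l2_dot x = Num.sqrt (limn (series (fun n => normc (x n) ^+ 2))).
Proof. by rewrite /form_norm l2_dotE. Qed.

Fact l2_complete : form_complete l2_dot.
Proof.
move=> u cu.
have coef_le (x : l2) k e : form_norm l2_dot x < e ->
    `|complex.Re (x k)| < e /\ `|complex.Im (x k)| < e.
  rewrite l2_normE => xe.
  have le1 : normc (x k) ^+ 2 <= limn (series (fun n => normc (x n) ^+ 2)).
    apply: le_trans (l2_partial_le x k.+1).
    rewrite /series/= big_nat_recr//= lerDr sumr_ge0// => *; exact: sqr_ge0.
  move: le1; rewrite normc_sqrE => le1.
  have p0 := le_trans (addr_ge0 (sqr_ge0 _) (sqr_ge0 _)) le1.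
  split; apply: le_lt_trans xe; rewrite -sqrtr_sqr ler_sqrt//;
    apply: le_trans le1; rewrite ?lerDl ?lerDr; exact: sqr_ge0.
have ReB (z w : R[i]) : complex.Re (z - w) = complex.Re z - complex.Re w.
  by case: z w => ? ? [].
have ImB (z w : R[i]) : complex.Im (z - w) = complex.Im z - complex.Im w.
  by case: z w => ? ? [].
have cRe k : cvgn (fun n => complex.Re (u n k)).
  apply/cauchy_cvgP/cauchy_ballP => e e0; near_simpl.
  move: (cu e e0); apply: filterS => -[m n] /= /(coef_le _ k)[+ _].
  rewrite (_ : (u m - u n) k = u m k - u n k)// /ball/= /ball_/=.
  by rewrite ReB.
have cIm k : cvgn (fun n => complex.Im (u n k)).
  apply/cauchy_cvgP/cauchy_ballP => e e0; near_simpl.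
  move: (cu e e0); apply: filterS => -[m n] /= /(coef_le _ k)[_ +].
  rewrite (_ : (u m - u n) k = u m k - u n k)// /ball/= /ball_/=.
  by rewrite ImB.
pose l k : R[i] := limn (fun n => complex.Re (u n k)) +i*
                   limn (fun n => complex.Im (u n k)).
have key e : 0 < e -> \forall m \near \oo, forall M,
    series (fun k => normc (u m k - l k) ^+ 2) M <= e ^+ 2.
  move=> e0; have [[P Q] /= [PN QN] PQ] := cu e e0.
  apply: filterS PN => m Pm M.
  have cs : (fun n => series (fun k => normc (u m k - u n k) ^+ 2) M) @ \oo -->
      series (fun k => normc (u m k - l k) ^+ 2) M.
    elim: M => [|k IH].
      rewrite /series/= big_geq//.
      by under eq_fun do rewrite big_geq//; exact: cvg_cst.
    rewrite /series/= big_nat_recr//=.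
    under eq_fun do rewrite big_nat_recr//=.
    apply: cvgD; first exact: IH.
    under eq_fun do rewrite normc_sqrE.
    rewrite normc_sqrE.
    apply: cvgD; under eq_fun do rewrite expr2; rewrite expr2.
    - have : (fun n => complex.Re (u m k - u n k)) @ \oo --> complex.Re (u m k - l k).
        rewrite ReB; under eq_fun do rewrite ReB.
        by apply: cvgB; [exact: cvg_cst|exact: cRe].
      by move=> c; apply: cvgM.
    - have : (fun n => complex.Im (u m k - u n k)) @ \oo --> complex.Im (u m k - l k).
        rewrite ImB; under eq_fun do rewrite ImB.
        by apply: cvgB; [exact: cvg_cst|exact: cIm].
      by move=> c; apply: cvgM.
  rewrite -(cvg_lim _ cs)//; apply: limr_le; first by apply/cvg_ex; eexists; exact: cs.
  apply: filterS QN => n Qn.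
  have := PQ (m, n) (conj Pm Qn); rewrite /= l2_normE => /ltW le1.
  have := l2_partial_le (u m - u n) M => le2; apply: (le_trans le2).
  have p0 : 0 <= limn (series (fun k => normc ((u m - u n) k) ^+ 2)).
    apply: le_trans (l2_partial_le (u m - u n) 0).
    by rewrite /series/= big_geq.
  by rewrite -(sqr_sqrtr p0) lerXn2r// ?nnegrE ?sqrtr_ge0// ltW.
have diff_cvg m e : (forall M, series (fun k => normc (u m k - l k) ^+ 2) M <= e) ->
    cvgn (series (fun k => normc (u m k - l k) ^+ 2)).
  move=> me; apply: nondecreasing_is_cvgn.
    by apply: nondecreasing_series => k _ _; exact: sqr_ge0.
  by exists e => _ [M _ <-].
have lS : l \in square_summable.
  have [m _ /(_ _ (leqnn _)) mP] := key 1 ltr01.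
  have dS : (fun k => u m k - l k) \in square_summable.
    by apply/asboolP; exact: diff_cvg mP.
  rewrite (_ : l = (u m : nat -> R[i]) - (fun k => u m k - l k)); last first.
    by apply/funext => k; rewrite !fctE opprB addrC subrK.
  by rewrite rpredB// l2_square_summable.
exists (L2 lS); apply/cvgrPdist_le => e e0.
apply: filterS (key e e0) => m mP.
rewrite sub0r normrN ger0_norm ?sqrtr_ge0// l2_normE -(ger0_norm (ltW e0)) -sqrtr_sqr.
rewrite ler_sqrt ?sqr_ge0//; apply: limr_le; first exact: diff_cvg mP.
by near=> M; exact: mP.
Unshelve. all: by end_near. Qed.

HB.instance Definition _ := Lmodule_isHilbert.Build R l2 l2_complete.

Definition l2_basis_seq (n : nat) : nat -> R[i] := fun k => (k == n)%:R.

Fact l2_basis_seq_summable n : l2_basis_seq n \in square_summable.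
Proof.
apply/asboolP; apply: (@is_cvg_near_cst _ _ (1 : R)).
exists n.+1 => // m /= nm.
rewrite /series/= /index_iota subn0 (bigD1_seq n)/= ?iota_uniq//; last first.
  by rewrite mem_iota add0n.
rewrite /l2_basis_seq eqxx normc1 expr1n big1 ?addr0// => i /negPf ->.
by rewrite normc0 expr0n.
Qed.

Definition l2_basis (n : nat) : l2 := L2 (l2_basis_seq_summable n).

End l2.

Section bounded_operators.
Variable R : realType.

Record bounded_operator (H K : hilbertType R) := BoundedOperator {
  bounded_operator_linear :> {linear H -> K} ;
  bounded_operator_bounded :
    exists M : R, forall h, hnorm (bounded_operator_linear h) <= M * hnorm h }.

Definition similar_operators (H K : hilbertType R)
    (A : bounded_operator H H) (B : bounded_operator K K) : Prop :=
  exists2 Y : bounded_operator H K, bijective Y & forall h, Y (A h) = B (Y h).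

Definition adjoint (H : hilbertType R) (A B : bounded_operator H H) : Prop :=
  forall x y : H, hdot (A x) y = hdot x (B y).

(* [N'] is the adjoint of [N], which exists and is unique on a Hilbert space. *)
Definition normal_operator (H : hilbertType R) (N : bounded_operator H H) : Prop :=
  exists2 N' : bounded_operator H H,
    adjoint N N' & forall x, N (N' x) = N' (N x).

(* The inclusion of [H] in the larger space is an isometric embedding [J]. *)
Definition subnormal (H : hilbertType R) (T : bounded_operator H H) : Prop :=
  exists (K : hilbertType R) (J : {linear H -> K}) (N : bounded_operator K K),
    [/\ forall x y, hdot (J x) (J y) = hdot x y,
        normal_operator N &
        forall h, N (J h) = J (T h)].

(* [0 <= z] in [R[i]] means that [z] is real and nonnegative. *)
Definition conditionally_positive_definite (H : hilbertType R)
    (T : bounded_operator H H) : Prop :=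
  forall (h : H) (k : nat) (alpha : 'I_k.+1 -> R[i]),
    \sum_(j < k.+1) alpha j = 0 ->
    0 <= \sum_(i < k.+1) \sum_(j < k.+1)
           (hnorm (iter (i + j) T h) ^+ 2)%:C * alpha i * Num.conj (alpha j).

(* A bounded operator on [l2] is determined by its values on the basis. *)
Definition is_weighted_shift (lambda : nat -> R)
    (W : bounded_operator (l2 R) (l2 R)) : Prop :=
  [/\ forall n, 0 < lambda n,
      exists M, forall n, lambda n <= M &
      forall n, W (l2_basis R n) = (lambda n)%:C *: l2_basis R n.+1].

End bounded_operators.

Section scalar_representing_triplet.
Variable R : realType.
Implicit Types (lambda : nat -> R) (b c : R).
Implicit Types (nu : {finite_measure set (measurableTypeR R) -> \bar R}).

Definition measure_support nu : set R :=
  [set x | forall U : set R, open U -> U x -> (0 < nu U)%E].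

Definition lambda_hat lambda (n : nat) : R := \prod_(i < n) lambda i ^+ 2.

(* The sum is empty for [n = 0] and [n = 1]. *)
Definition Qpoly (n : nat) (x : R) : R :=
  \sum_(0 <= j < n.-1) (n - j - 1)%:R * x ^+ j.

(* A measure on the half-line is a measure on [R] that does not charge the
   negative reals.  The identity is stated in [\bar R]; compactness of the
   support makes every [Qpoly n] integrable. *)
Definition is_scalar_representing_triplet lambda b c nu : Prop :=
  [/\ 0 <= c,
      nu [set x : R | x < 0] = 0%E,
      compact (measure_support nu),
      nu [set 1] = 0%E &
      forall n, ((lambda_hat lambda n)%:E =
        (1 + b * n%:R + c * n%:R ^+ 2)%:E +
        \int[nu]_(x in `[0%R, +oo[) (Qpoly n x)%:E)%E].

(* [c] and [nu] are those of the scalar representing triplet. *)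
Definition type_III c nu : Prop :=
  ~ (measure_support nu `<=` [set 0]) \/ c != 0.

End scalar_representing_triplet.

(* Main.v *)
From HB Require Import structures.
Require Import Defs.
From mathcomp Require Import all_boot all_order all_algebra.
From mathcomp Require Import sesquilinear complex ring lra.
From mathcomp Require Import all_classical all_reals all_analysis.
From mathcomp Require Import measurable_realfun.

(** Why the theorem holds.  Write [gam n] for the n-th entry of the moment
    sequence [lambda_hat] and [E] for the set [0, 1) U (1, theta], which carries
    the measure [nu].

    Type III is immediate, because the atom puts [theta], a nonzero number, in
    the support.

    Similarity.  The polynomials [Qpoly n] have nonnegative coefficients, hence
    are largest on the support at [theta], where they grow like [theta ^+ n];
    the linear and quadratic terms of the triplet are negligible against that.
    So [gam n <= C * theta ^+ n], while the atom at [theta] gives the matching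
    lower bound ([growth_bounds]).  Two weighted shifts whose moment sequences
    are comparable are intertwined by an invertible diagonal operator
    ([weighted_shift_similar]), and [theta ^+ n] is the moment sequence of
    [sqrt theta] times the unilateral shift, which is subnormal: its extension
    is [sqrt theta] times the bilateral shift ([scaled_shift_subnormal]).  The
    bilateral shift is realised on the same space l2, by folding the integers
    onto the natural numbers.

    Non-subnormality.  If the shift were subnormal, [gam (i + j)] would be a
    Gram matrix ([normal_orbit_gram]), so the functional sending ['X^n] to
    [gam n] would be nonnegative on squares.  The triplet says that this
    functional, twisted by [('X - 1) ^+ 2], is integration against [nu] plus
    [2 * c] times evaluation at 1 ([moment_twisted]).  Evaluating it at the
    square of [1 - ('X - 1) * q] gives an inequality for every polynomial [q]
    ([test_inequality]); three choices of [q], built from a polynomial bump at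
    1, are enough.  A suitable multiple of [('X - 1)] times a sharp bump forces
    [c = 0]; an approximation of [1 / (x - 1)] forces
    the integral of [1 / (x - 1) ^+ 2] to be at most 1; an arbitrary multiple of
    the bump itself forces [b] to be the integral of [1 / (x - 1)].  Each of
    the three conditions of the theorem denies one of these conclusions. *)

Set Implicit Arguments.
Unset Strict Implicit.
Unset Printing Implicit Defensive.

Import Order.TTheory GRing.Theory Num.Theory.
Import numFieldNormedType.Exports.
Import ComplexField.Normc.

Local Open Scope classical_set_scope.
Local Open Scope ring_scope.
Local Open Scope complex_scope.

(** * Hilbert spaces and subnormality *)

Section HilbertForms.
Variables (R : realType).
Implicit Types (H K : hilbertType R).

Lemma hdotC {H} (x y : H) : hdot x y = Num.conj (hdot y x).
Proof. by rewrite hermC expr0 mul1r. Qed.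

Lemma hdot_normE {H} (x : H) : hdot x x = (hnorm x ^+ 2)%:C.
Proof.
have : 0 <= hdot x x := dnorm_ge0 _ x.
rewrite /form_norm; case: (hdot x x) => a b /=.
rewrite lecE /= => /andP[/eqP b0 a0].
by rewrite b0 in a0 *; rewrite sqr_sqrtr.
Qed.

Lemma hnorm_ge0 {H} (x : H) : 0 <= hnorm x.
Proof. exact: sqrtr_ge0. Qed.

Lemma hnormZ {H} (a : R[i]) (x : H) :
  hnorm (a *: x) = ComplexField.Normc.normc a * hnorm x.
Proof.
apply/eqP; rewrite -(@eqrXn2 _ 2) ?mulr_ge0 ?hnorm_ge0//; last first.
  by case: a => ? ?; exact: sqrtr_ge0.
apply/eqP/complexI; rewrite -hdot_normE linearZl_LR linearZr_LR /= hdot_normE.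
rewrite exprMn normc_sqrE; case: a => a b; apply/eqP; rewrite eq_complex /=.
by apply/andP; split; apply/eqP; ring.
Qed.

(** Polarization: the diagonal at [x + y] yields the real part of a dot product
    and the diagonal at [x + i y] its imaginary part. *)
Lemma isometry_hdot {H K} (J : {linear H -> K}) :
  (forall x, hnorm (J x) = hnorm x) -> forall x y, hdot (J x) (J y) = hdot x y.
Proof.
move=> Jn x y.
have diag z : hdot (J z) (J z) = hdot z z by rewrite !hdot_normE Jn.
have := diag (x + y); have := diag (x + (0 +i* 1) *: y).
rewrite !linearD !linearZ /= !linearDl !linearDr !linearZl_LR !linearZr_LR /=.
rewrite !diag (hdotC (J y) (J x)) (hdotC y x).
case: (hdot (J x) (J y)) (hdot x y) (hdot x x) (hdot y y) =>
  [a b] [a' b'] [c d] [c' d'].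
move=> /eqP; rewrite eq_complex /= => /andP[/eqP e1 /eqP _].
move=> /eqP; rewrite eq_complex /= => /andP[/eqP e2 /eqP _].
by congr (_ +i* _); lra.
Qed.

(** Normality lets the powers of [N] and of its adjoint [N'] be regrouped, so
    the squared norms along an orbit form the Gram matrix of the vectors
    [N'^i N^i h]. *)
Lemma normal_orbit_gram {H} (N : bounded_operator H H) (h : H) :
  normal_operator N -> exists P : nat -> H,
    forall i j, hdot (P i) (P j) = (hnorm (iter (i + j) N h) ^+ 2)%:C.
Proof.
case=> N' adjN NN'.
exists (fun i => iter i N' (iter i N h)) => i j.
have adjI k x y : hdot (iter k N x) y = hdot x (iter k N' y).
  by elim: k x y => [//|k IH] x y; rewrite iterS adjN IH -iterSr.
have adjI' k x y : hdot (iter k N' x) y = hdot x (iter k N y).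
  by rewrite hdotC -adjI -hdotC.
have comm1 k x : N (iter k N' x) = iter k N' (N x).
  by elim: k => //= k <-.
have comm k l x : iter l N (iter k N' x) = iter k N' (iter l N x).
  by elim: l => //= l ->.
by rewrite -adjI comm adjI' -!iterD (addnC j) hdot_normE.
Qed.

Lemma iter_intertwine {H K} (T : bounded_operator H H) (N : bounded_operator K K)
    (J : H -> K) : (forall h, N (J h) = J (T h)) ->
  forall n h, iter n N (J h) = J (iter n T h).
Proof. by move=> NJ n h; elim: n => //= n ->. Qed.

(** The double sum is the squared norm of a linear combination of the Gram
    vectors of the normal extension. *)
Lemma subnormal_orbit_psd {H} (T : bounded_operator H H) (h : H) :
  subnormal T -> forall (n : nat) (a : nat -> R),
  0 <= \sum_(i < n) \sum_(j < n) a i * a j * hnorm (iter (i + j) T h) ^+ 2.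
Proof.
case=> K [J] [N] [isoJ normN NJ] n a.
have [P gramP] := normal_orbit_gram (J h) normN.
have normJ x : hnorm (J x) = hnorm x by rewrite /form_norm isoJ.
rewrite -lecR; have : 0 <= hdot (\sum_(i < n) (a i)%:C *: P i)
                               (\sum_(i < n) (a i)%:C *: P i) := dnorm_ge0 _ _.
congr (_ <= _); rewrite linear_sumlz rmorph_sum /=; apply: eq_bigr => i _.
rewrite linear_sumr rmorph_sum /=; apply: eq_bigr => j _.
rewrite linearZl_LR linearZr_LR /= gramP (iter_intertwine NJ) normJ.
rewrite !rmorphM /= mulrA; congr (_ * _ * _); exact: conjc_real.
Qed.

End HilbertForms.

(** * Weighted relabelling operators on l2 *)

Section WeightedRelabelling.
Variable R : realType.
Implicit Types (x : l2 R) (a w : nat -> R).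
Implicit Types (g : nat -> option nat) (h : nat -> nat).

Lemma normc_ge0 (z : R[i]) : 0 <= normc z.
Proof. by case: z => ? ?; exact: sqrtr_ge0. Qed.

Lemma hnorm_sqrE x : hnorm x ^+ 2 = limn (series (fun n => normc (x n) ^+ 2)).
Proof.
rewrite l2_normE sqr_sqrtr//; apply: le_trans (l2_partial_le x 0).
by rewrite /series /= big_geq.
Qed.

Lemma hnorm_basis n : hnorm (l2_basis R n) = 1.
Proof.
apply/eqP; rewrite -(@eqrXn2 _ 2) ?hnorm_ge0// expr1n hnorm_sqrE; apply/eqP.
apply: lim_near_cst => //; exists n.+1 => // m /= nm.
rewrite /series /= (bigD1_seq n) ?iota_uniq ?mem_index_iota//=.
rewrite /l2_basis_seq eqxx normc1 expr1n big1 ?addr0// => i /negPf ->.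
by rewrite normc0 expr0n.
Qed.

(** [ocancel g h] makes [g] injective where it is defined, so each term of [a]
    is met at most once. *)
Lemma sum_relabel_le g h a n : ocancel g h -> (forall k, 0 <= a k) ->
  exists m, \sum_(0 <= k < n) oapp a 0 (g k) <= \sum_(0 <= k < m) a k.
Proof.
move=> gh a0; pose s := pmap g (index_iota 0 n).
have us : uniq s by rewrite (pmap_uniq gh)// iota_uniq.
exists (\max_(j <- s) j).+1; rewrite [leRHS](bigID (mem s))/=.
have -> : \sum_(0 <= k < n) oapp a 0 (g k) = \sum_(j <- s) a j.
  by rewrite /s; elim: (index_iota 0 n) => [|k l IH]; rewrite ?big_nil//=
    big_cons IH; case: (g k) => [j|] /=; rewrite ?big_cons ?add0r.
rewrite -[X in _ <= X + _]big_filter.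
have /(perm_big _) -> :
    perm_eq s [seq i <- index_iota 0 (\max_(j <- s) j).+1 | i \in s].
  apply: uniq_perm => //; first by rewrite filter_uniq// iota_uniq.
  move=> j; rewrite mem_filter mem_index_iota /=; case js: (j \in s) => //=.
  by rewrite ltnS leq_bigmax_seq.
by rewrite lerDl sumr_ge0.
Qed.

(** One construction covers every operator needed below: shifts, diagonal
    operators, permutations of the basis and the embedding of l2 into a larger
    copy of itself.  Coordinate [k] of the image is [w k] times coordinate [g k]
    of [x], and 0 where [g] is undefined. *)
Definition relabel_seq w g (x : nat -> R[i]) : nat -> R[i] :=
  fun k => (w k)%:C * oapp x 0 (g k).

Lemma relabel_partial_le M w g h x n : ocancel g h -> (forall k, `|w k| <= M) ->
  series (fun k => normc (relabel_seq w g x k) ^+ 2) n <= M ^+ 2 * hnorm x ^+ 2.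
Proof.
move=> gh wM; have M0 : 0 <= M := le_trans (normr_ge0 _) (wM 0%N).
have [m le_m] := sum_relabel_le n gh (fun k => sqr_ge0 (normc (x k))).
have := le_trans le_m (l2_partial_le x m); rewrite -hnorm_sqrE => le_x.
apply: le_trans (ler_wpM2l (sqr_ge0 M) le_x).
rewrite mulr_sumr; apply: ler_sum => k _; rewrite /relabel_seq normcM exprMn.
have -> : normc (oapp x 0 (g k)) ^+ 2 = oapp (fun k => normc (x k) ^+ 2) 0 (g k).
  case: (g k) => //; change (normc (0 : R[i]) ^+ 2 = 0 :> R).
  by rewrite normc0 expr0n.
apply: ler_wpM2r; first by case: (g k) => //= j; exact: sqr_ge0.
by rewrite normc_sqrE /= expr0n addr0 -real_normK ?num_real// lerXn2r// nnegrE.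
Qed.

Lemma relabel_summable M w g h x : ocancel g h -> (forall k, `|w k| <= M) ->
  relabel_seq w g x \in @square_summable R.
Proof.
move=> gh wM; apply/asboolP; apply: nondecreasing_is_cvgn.
  by apply: nondecreasing_series => k _ _; exact: sqr_ge0.
exists (M ^+ 2 * hnorm x ^+ 2) => _ [n _ <-].
exact: relabel_partial_le gh wM.
Qed.

Definition relabel_fun M w g h (gh : ocancel g h) (wM : forall k, `|w k| <= M) x
  : l2 R := L2 (relabel_summable x gh wM).

Lemma relabel_fun_linear M w g h gh wM : linear (@relabel_fun M w g h gh wM).
Proof.
move=> a x y; apply: val_inj; apply/funext => k /=.
change (relabel_seq w g (a *: x + y : l2 R) k =
  a * relabel_seq w g x k + relabel_seq w g y k).
rewrite /relabel_seq; case: (g k) => [j|] /=; last by rewrite !mulr0 addr0.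
change ((w k)%:C * (a * x j + y j) =
  a * ((w k)%:C * x j) + (w k)%:C * y j).
by ring.
Qed.

HB.instance Definition _ M w g h gh wM :=
  GRing.isLinear.Build R[i] (l2 R) (l2 R) _ (@relabel_fun M w g h gh wM)
    (relabel_fun_linear gh wM).

Lemma relabel_fun_le M w g h gh wM x :
  hnorm (@relabel_fun M w g h gh wM x) <= M * hnorm x.
Proof.
have M0 : 0 <= M := le_trans (normr_ge0 _) (wM 0%N).
rewrite -(@ler_pXn2r _ 2) ?nnegrE ?mulr_ge0 ?hnorm_ge0// exprMn hnorm_sqrE.
apply: limr_le; first exact: l2_cvg.
by apply: nearW => n; exact: relabel_partial_le gh wM.
Qed.

Definition relabel M w g h (gh : ocancel g h) (wM : forall k, `|w k| <= M)
    : bounded_operator (l2 R) (l2 R) :=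
  @BoundedOperator R _ _ (@relabel_fun M w g h gh wM : {linear _ -> _})
    (ex_intro _ M (@relabel_fun_le M w g h gh wM)).

Lemma coef_le_hnorm x k : normc (x k) <= hnorm x.
Proof.
rewrite -(@ler_pXn2r _ 2) ?nnegrE ?normc_ge0 ?hnorm_ge0// hnorm_sqrE.
apply: le_trans (l2_partial_le x k.+1).
by rewrite /series /= big_nat_recr//= lerDr sumr_ge0// => *; exact: sqr_ge0.
Qed.

Definition l2_trunc x n : l2 R := \sum_(k < n) x k *: l2_basis R k.

Lemma l2_truncE x n k : l2_trunc x n k = if (k < n)%N then x k else 0.
Proof.
rewrite /l2_trunc; elim: n => [|n IH]; first by rewrite big_ord0.
rewrite big_ord_recr /=.
change ((\sum_(i < n) x i *: l2_basis R i : l2 R) k + x n * (k == n)%:R =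
  if (k < n.+1)%N then x k else 0).
rewrite IH [in RHS]ltnS [in RHS]leq_eqVlt; have [->|kn] := eqVneq k n.
  by rewrite ltnn add0r mulr1.
by rewrite mulr0 addr0.
Qed.

Lemma l2_trunc_cvg x : (fun n => hnorm (x - l2_trunc x n) ^+ 2) @ \oo --> 0.
Proof.
pose s := series (fun n => normc (x n) ^+ 2).
have -> : (fun n => hnorm (x - l2_trunc x n) ^+ 2) = (fun n => limn s - s n).
  apply/funext => n; rewrite hnorm_sqrE.
  apply: cvg_lim => //.
  have : (fun m => s m - s n) @ \oo --> limn s - s n.
    by apply: cvgB; [exact: l2_cvg|exact: cvg_cst].
  apply: cvg_trans; apply: near_eq_cvg; exists n => // m /= nm.
  rewrite !fctE/= /s /series /= (big_cat_nat _ nm)//= addrAC subrr add0r.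
  rewrite [RHS](big_cat_nat _ nm)//= [X in _ = X + _]big_nat.
  rewrite [X in _ = X + _]big1 ?add0r => [|k /andP[_ kn]].
    apply: eq_big_nat => k /andP[nk _].
    change (normc (x k) ^+ 2 = normc (x k - l2_trunc x n k) ^+ 2).
    by rewrite l2_truncE ltnNge nk subr0.
  change (normc (x k - l2_trunc x n k) ^+ 2 = 0).
  by rewrite l2_truncE kn subrr normc0 expr0n.
by rewrite -(subrr (limn s)); apply: cvgB; [exact: cvg_cst|exact: l2_cvg].
Qed.

(** The truncations of [x] converge to [x], and both operators are bounded, so
    the coordinates of [A x - B x] are arbitrarily small. *)
Lemma eq_on_basis (A B : bounded_operator (l2 R) (l2 R)) :
  (forall n, A (l2_basis R n) = B (l2_basis R n)) -> forall x, A x = B x.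
Proof.
move=> AB x; apply: val_inj; apply/funext => k.
have [MA leA] := bounded_operator_bounded A.
have [MB leB] := bounded_operator_bounded B.
apply/eqP; rewrite -subr_eq0; apply/eqP/eq0_normc.
pose r n := x - l2_trunc x n.
have small n : normc (A x k - B x k) ^+ 2 <=
    (2 * (MA ^+ 2 + MB ^+ 2)) * hnorm (r n) ^+ 2.
  have AEB : A (l2_trunc x n) = B (l2_trunc x n).
    by rewrite !linear_sum; apply: eq_bigr => i _; rewrite !linearZ /= AB.
  have -> : A x k - B x k = A (r n) k - B (r n) k.
    rewrite /r !linearB /= AEB.
    change (A x k - B x k = (A x k - B (l2_trunc x n) k)
      + (- B x k - - B (l2_trunc x n) k)).
    by ring.
  have bnd (C : bounded_operator (l2 R) (l2 R)) M :
      (forall y, hnorm (C y) <= M * hnorm y) ->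
      normc (C (r n) k) ^+ 2 <= M ^+ 2 * hnorm (r n) ^+ 2.
    move=> CM; rewrite -exprMn lerXn2r ?nnegrE ?normc_ge0//.
      by apply: le_trans (CM _); rewrite hnorm_ge0.
    exact: le_trans (coef_le_hnorm _ _) (CM _).
  apply: le_trans (normc_sqrD _ _) _; rewrite -mulrA ler_pM2l// mulrDl lerD ?bnd//.
  rewrite (_ : normc (- _) = normc (B (r n) k)) ?bnd//.
  by case: (B (r n) k) => ? ? /=; rewrite !sqrrN.
apply/eqP; rewrite -sqrf_eq0 eq_le sqr_ge0 andbT.
have c : (fun n => 2 * (MA ^+ 2 + MB ^+ 2) * hnorm (r n) ^+ 2) @ \oo --> 0.
  rewrite -(mulr0 (2 * (MA ^+ 2 + MB ^+ 2))).
  by apply: cvgM; [exact: cvg_cst|exact: l2_trunc_cvg].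
rewrite -(cvg_lim _ c)//; apply: limr_ge; first by apply/cvg_ex; eexists; exact: c.
by apply: nearW => n; exact: small.
Qed.

End WeightedRelabelling.

(** * Similarity of a weighted shift to a multiple of the unilateral shift *)

Section ShiftSimilarity.
Variable R : realType.
Implicit Types (x y : l2 R) (g : nat -> option nat) (h : nat -> nat).

Lemma relabelE (M : R) w g h gh wM x k :
  @relabel R M w g h gh wM x k = (w k)%:C * oapp x 0 (g k).
Proof. by []. Qed.

Lemma l2P x y : (forall k, x k = y k) -> x = y.
Proof. by move=> xy; apply: val_inj; apply/funext. Qed.

Lemma relabel_basis (M : R) w g h gh wM n : g (h n) = Some n ->
  @relabel R M w g h gh wM (l2_basis R n) = (w (h n))%:C *: l2_basis R (h n).
Proof.
move=> ghn; apply: l2P => k; rewrite relabelE.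
change ((w k)%:C * oapp (l2_basis_seq R n) 0 (g k) =
  (w (h n))%:C * l2_basis_seq R (h n) k).
rewrite /l2_basis_seq; have [->|kn] := eqVneq k (h n); first by rewrite ghn /= eqxx.
have := gh k; case: (g k) => [j|] /= hj; last by rewrite !mulr0.
by have [jn|_] := eqVneq j n; rewrite ?mulr0//; rewrite -hj jn eqxx in kn.
Qed.

(** When every coordinate is kept, relabelling along [h] undoes relabelling
    along [g]; both are contractions, hence the first is an isometry. *)
Lemma relabel_isometry g h gh wM : (forall j, g (h j) = Some j) ->
  forall x, hnorm (@relabel R 1 (fun=> 1) g h gh wM x) = hnorm x.
Proof.
move=> ghK x; set y := relabel _ _ x.
have hK : ocancel (Some \o h) (fun k => odflt 0%N (g k)).
  by move=> k /=; rewrite ghK.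
have xE : @relabel R 1 (fun=> 1) _ _ hK wM y = x.
  by apply: l2P => k; rewrite relabelE /= /relabel_seq ghK /= !mul1r.
have le1 g' h' gh' z : hnorm (@relabel R 1 (fun=> 1) g' h' gh' wM z) <= hnorm z.
  by rewrite -[leRHS]mul1r; exact: relabel_fun_le.
by apply/eqP; rewrite eq_le le1 /= -[in leLHS]xE le1.
Qed.

Lemma normr_cst_le (r : R) : 0 <= r -> nat -> `|r| <= r.
Proof. by move=> r0 _; rewrite ger0_norm. Qed.

Lemma relabel_cst (r : R) g h gh rM oneM x :
  @relabel R r (fun=> r) g h gh rM x =
  r%:C *: @relabel R 1 (fun=> 1) g h gh oneM x.
Proof.
apply: l2P => k; change (r%:C * oapp x 0 (g k) = r%:C * (1%:C * oapp x 0 (g k))).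
by rewrite mul1r.
Qed.

Definition unshift (k : nat) : option nat := if k is j.+1 then Some j else None.

Lemma unshiftK : ocancel unshift S. Proof. by case. Qed.

Definition scaled_shift (r : R) (r0 : 0 <= r) : bounded_operator (l2 R) (l2 R) :=
  relabel unshiftK (normr_cst_le r0).

Lemma scaled_shift_basis (r : R) (r0 : 0 <= r) n :
  scaled_shift r0 (l2_basis R n) = r%:C *: l2_basis R n.+1.
Proof. exact: relabel_basis. Qed.

Lemma scaled_shift_weighted (r : R) (r0 : 0 <= r) : 0 < r ->
  is_weighted_shift (fun=> r) (scaled_shift r0).
Proof.
move=> r_gt0; split => //; first by exists r.
exact: scaled_shift_basis.
Qed.

(** The integers are folded onto the natural numbers by sending [n] to [2 n] and
    [- n - 1] to [2 n + 1]; [fold_succ] and [fold_pred] are the successor and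
    the predecessor in this encoding. *)
Definition fold_succ (k : nat) : nat :=
  if odd k then (if k is j.+2 then j else 0) else k.+2.

Definition fold_pred (k : nat) : nat :=
  if odd k then k.+2 else (if k is j.+2 then j else 1).

Lemma fold_succK : cancel fold_succ fold_pred.
Proof.
move=> [|[|k]] //; rewrite /fold_succ /= negbK; case ok: (odd k);
  by rewrite /fold_pred /= ?negbK ok.
Qed.

Lemma fold_predK : cancel fold_pred fold_succ.
Proof.
move=> [|[|k]] //; rewrite /fold_pred /= negbK; case ok: (odd k);
  by rewrite /fold_succ /= ?negbK ok.
Qed.

Lemma Some_ocancel (f f' : nat -> nat) : cancel f f' -> ocancel (Some \o f) f'.
Proof. by move=> fK k /=. Qed.

Definition even_half (k : nat) : option nat := if odd k then None else Some k./2.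

Lemma even_halfK : ocancel even_half double.
Proof. by move=> k; rewrite /even_half; case: ifPn => //= /even_halfK. Qed.

(** The normal extension is [r] times the bilateral shift, into which the
    unilateral shift embeds through the even indices. *)
Lemma scaled_shift_subnormal (r : R) (r0 : 0 <= r) : subnormal (scaled_shift r0).
Proof.
have le1 := normr_cst_le (@ler01 R).
pose J := relabel even_halfK le1.
pose U := relabel (Some_ocancel fold_predK) le1.
pose U' := relabel (Some_ocancel fold_succK) le1.
pose N := relabel (Some_ocancel fold_predK) (normr_cst_le r0).
pose N' := relabel (Some_ocancel fold_succK) (normr_cst_le r0).
have NE x : N x = r%:C *: U x by exact: relabel_cst.
have NE' x : N' x = r%:C *: U' x by exact: relabel_cst.
have UU' x : U (U' x) = x.
  by apply: l2P => k; rewrite relabelE /= /relabel_seq /= fold_predK !mul1r.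
have isoU x y : hdot (U x) (U y) = hdot x y.
  apply: isometry_hdot => z; apply: relabel_isometry => j /=.
  by rewrite fold_succK.
exists (l2 R), J, N; split.
- apply: isometry_hdot => z; apply: relabel_isometry => j.
  by rewrite /even_half odd_double doubleK.
- exists N' => [x y|x].
    rewrite NE NE' linearZl_LR linearZr_LR /= -[in LHS](UU' y) isoU.
    by congr (_ * _); rewrite -[LHS]conjc_real.
  apply: l2P => k; rewrite relabelE /= /relabel_seq /=.
  by rewrite fold_predK fold_succK.
- move=> x; apply: l2P => k; rewrite relabelE /= /relabel_seq /=.
  case: k => [|[|k]]; rewrite /fold_pred /even_half /unshift /= ?mulr0 ?mul1r//.
  by rewrite negbK; case ok: (odd k); rewrite /= ?negbK ok /= ?mulr0//.
Qed.

Lemma bounded_comp {H K L : hilbertType R} (A : bounded_operator K L)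
    (B : bounded_operator H K) :
  exists M, forall x : H, hnorm ((A \o B) x) <= M * hnorm x.
Proof.
have [MA leA] := bounded_operator_bounded A.
have [MB leB] := bounded_operator_bounded B.
exists (`|MA| * MB) => x /=; apply: le_trans (leA _) _.
apply: le_trans (ler_wpM2r (hnorm_ge0 _) (ler_norm MA)) _.
by rewrite -mulrA ler_wpM2l.
Qed.

Definition comp_op {H K L : hilbertType R} (A : bounded_operator K L)
    (B : bounded_operator H K) : bounded_operator H L :=
  @BoundedOperator R H L (A \o B : {linear _ -> _}) (bounded_comp A B).

(** The intertwining operator multiplies the basis vector [n] by [d n], where
    [d n ^+ 2] is the ratio of the two moment sequences: the bounds say exactly
    that it and its inverse are bounded. *)
Lemma weighted_shift_similar (lambda : nat -> R) W (r : R) (r0 : 0 <= r) (m C : R) :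
  is_weighted_shift lambda W -> 0 < r -> 0 < m ->
  (forall n, m * r ^+ (n.*2) <= lambda_hat lambda n <= C * r ^+ (n.*2)) ->
  similar_operators W (scaled_shift r0).
Proof.
case=> lam0 _ We r_gt0 m0 bounds.
(* Bounds on squares are turned into bounds without taking roots. *)
have le_sqr (z : R) : z <= 1 + z ^+ 2 by have := sqr_ge0 (z - 1); nra.
pose d n := \prod_(i < n) (r / lambda i).
have d0 n : 0 < d n by apply: prodr_gt0 => i _; rewrite divr_gt0.
have hat0 n : 0 < lambda_hat lambda n.
  by apply: prodr_gt0 => i _; rewrite exprn_gt0.
have d2 n : d n ^+ 2 = r ^+ (n.*2) / lambda_hat lambda n.
  rewrite /d /lambda_hat -prodrXl; under eq_bigr do rewrite expr_div_n.
  by rewrite big_split /= prodfV prodr_const card_ord -exprM mul2n.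
have dM n : `|d n| <= 1 + m^-1.
  rewrite gtr0_norm//; apply: le_trans (le_sqr _) _; rewrite lerD2l d2.
  rewrite ler_pdivrMr// -ler_pdivrMl ?invr_gt0// invrK.
  by have /andP[] := bounds n.
have d'M n : `|(d n)^-1| <= 1 + C.
  rewrite gtr0_norm ?invr_gt0//; apply: le_trans (le_sqr _) _.
  rewrite lerD2l exprVn d2 invf_div ler_pdivrMr ?exprn_gt0//.
  by have /andP[] := bounds n.
pose Y := relabel (Some_ocancel (fun=> erefl : id _ = _)) dM.
pose Y' := relabel (Some_ocancel (fun=> erefl : id _ = _)) d'M.
have dR n : (d n)%:C * ((d n)^-1)%:C = 1 by rewrite -rmorphM /= divff ?gt_eqF.
exists Y.
  exists Y' => x; apply: l2P => k; rewrite relabelE /= /relabel_seq /= mulrA.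
    by rewrite [X in X * _]mulrC dR mul1r.
  by rewrite dR mul1r.
apply: (@eq_on_basis _ (comp_op Y W) (comp_op (scaled_shift r0) Y)) => n /=.
rewrite We linearZ !relabel_basis// linearZ scaled_shift_basis /= !scalerA.
congr (_ *: _); rewrite -!rmorphM /=; congr (_%:C).
by rewrite /d big_ord_recr /=; field; rewrite gt_eqF.
Qed.

End ShiftSimilarity.

(** * Moment functionals and the polynomials Q *)

Section MomentFunctional.
Variable R : realType.
Implicit Types (a : nat -> R) (p q : {poly R}).

(** The Riesz functional of the sequence [a]: the linear form on polynomials that
    sends ['X^n] to [a n]. *)
Definition moment a p : R := \sum_(i < size p) p`_i * a i.

Lemma moment_widen a p n : (size p <= n)%N -> moment a p = \sum_(i < n) p`_i * a i.
Proof.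
move=> pn; rewrite /moment -(big_mkord xpredT (fun i => p`_i * a i)).
rewrite -(big_mkord xpredT (fun i => p`_i * a i)) [RHS](big_cat_nat _ pn)//=.
rewrite [X in _ = _ + X]big_nat [X in _ = _ + X]big1 ?addr0// => i /andP[ip _].
by rewrite nth_default// mul0r.
Qed.

Lemma moment_is_linear a : linear_for *%R (moment a).
Proof.
move=> k p q; set n := maxn (size (k *: p + q)) (maxn (size p) (size q)).
have lep : (size p <= n)%N by rewrite !leq_max leqnn orbT.
have leq : (size q <= n)%N by rewrite !leq_max leqnn !orbT.
have lepq : (size (k *: p + q)%R <= n)%N by rewrite leq_max leqnn.
rewrite (moment_widen _ lep) (moment_widen _ leq) (moment_widen _ lepq).
rewrite mulr_sumr -big_split /=; apply: eq_bigr => i _.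
by rewrite coefD coefZ mulrDl mulrA.
Qed.

HB.instance Definition _ a :=
  GRing.isLinear.Build R {poly R} R _ (moment a) (@moment_is_linear a).

Lemma momentD a p q : moment a (p + q) = moment a p + moment a q.
Proof. exact: linearD. Qed.

Lemma momentB a p q : moment a (p - q) = moment a p - moment a q.
Proof. exact: linearB. Qed.

Lemma momentZ a k p : moment a (k *: p) = k * moment a p.
Proof. by rewrite linearZ. Qed.

Lemma moment_combination k a a' p :
  moment (fun n => k * a n + a' n) p = k * moment a p + moment a' p.
Proof.
rewrite /moment mulr_sumr -big_split /=; apply: eq_bigr => i _; ring.
Qed.

Lemma moment_mulX a p : moment a ('X * p) = moment (fun n => a n.+1) p.
Proof.
rewrite (@moment_widen a ('X * p) (size p).+1); last first.
  by rewrite (leq_trans (size_polyMleq _ _))// size_polyX.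
rewrite big_ord_recl coefXM mul0r add0r; apply: eq_bigr => i _.
by rewrite coefXM.
Qed.

Lemma moment_mulXn a n p : moment a ('X^n * p) = moment (fun k => a (n + k)%N) p.
Proof.
elim: n a => [|n IH] a; first by rewrite mul1r.
by rewrite exprS -mulrA moment_mulX IH.
Qed.

Lemma moment_Xn a n : moment a 'X^n = a n.
Proof.
rewrite -['X^n]mulr1 moment_mulXn /moment size_poly1 big_ord1.
by rewrite coef1 mul1r addn0.
Qed.

Lemma moment1 a : moment a 1 = a 0%N.
Proof. by rewrite -(expr0 'X) moment_Xn. Qed.

Lemma moment_powers x p : moment (fun n => x ^+ n) p = p.[x].
Proof. by rewrite horner_coef. Qed.

Lemma moment_mul a p q :
  moment a (p * q) = \sum_(i < size p) \sum_(j < size q) p`_i * q`_j * a (i + j)%N.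
Proof.
rewrite -[in LHS](coefK p) poly_def mulr_suml linear_sum; apply: eq_bigr => i _.
rewrite -scalerAl linearZ /= moment_mulXn /moment mulr_sumr.
by apply: eq_bigr => j _; rewrite mulrA.
Qed.

(** Second differences are what makes the representing formula usable: they kill
    its affine part and turn [Qpoly n] into the n-th power. *)
Lemma moment_second_difference a p : moment a (('X - 1) ^+ 2 * p) =
  moment (fun n => a n.+2 - 2 * a n.+1 + a n) p.
Proof.
have -> : ('X - 1) ^+ 2 * p = 'X * ('X * p) - 2 *: ('X * p) + p.
  by rewrite scaler_nat; ring.
rewrite momentD momentB momentZ !moment_mulX -(mul1r (moment (fun n => a n.+2) p)).
rewrite -mulNr addrAC -moment_combination addrC -moment_combination.
by congr moment; apply/funext => n; ring.
Qed.

End MomentFunctional.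

Section QPolynomials.
Variable R : realType.

(** The summand at [j = n - 1] is zero, so summing up to [n] instead of [n - 1]
    changes nothing and makes the differences in [n] simple. *)
Definition Qpoly_poly n : {poly R} :=
  \sum_(0 <= j < n) (n - j - 1)%:R *: 'X^j.

Lemma Qpoly_polyE n x : (Qpoly_poly n).[x] = Qpoly n x.
Proof.
rewrite /Qpoly_poly /Qpoly; case: n => [|n] /=; first by rewrite !big_geq// horner0.
rewrite big_nat_recr//= subSnn subn1 scale0r addr0 horner_sum.
by apply: eq_bigr => j _; rewrite hornerZ hornerXn.
Qed.

Lemma Qpoly_poly_difference n :
  Qpoly_poly n.+1 - Qpoly_poly n = \sum_(0 <= j < n) 'X^j.
Proof.
rewrite /Qpoly_poly big_nat_recr//= subSnn subn1 scale0r addr0.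
rewrite -sumrB; apply: eq_big_nat => j /andP[_ jn].
rewrite -scalerBl subSn 1?ltnW// subn1 /=.
rewrite -[in X in X - _](@prednK (n - j)) ?subn_gt0//.
by rewrite subn1 -natr1 addrC addKr scale1r.
Qed.

Lemma Qpoly_poly_second_difference n :
  Qpoly_poly n.+2 - 2 *: Qpoly_poly n.+1 + Qpoly_poly n = 'X^n.
Proof.
have := Qpoly_poly_difference n.+1; rewrite big_nat_recr//= -Qpoly_poly_difference.
by move=> e; rewrite scaler_nat mulr2n opprD addrA e; ring.
Qed.

Lemma Qpoly_ge0 n (x : R) : 0 <= x -> 0 <= Qpoly n x.
Proof. by move=> x0; apply: sumr_ge0 => j _; rewrite mulr_ge0// exprn_ge0. Qed.

Lemma Qpoly_le n (x y : R) : 0 <= x -> x <= y -> Qpoly n x <= Qpoly n y.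
Proof.
move=> x0 xy; apply: ler_sum => j _; apply: ler_wpM2l => //.
by rewrite lerXn2r// nnegrE// (le_trans x0).
Qed.

Lemma Qpoly_recr n (x : R) : Qpoly n.+1 x = Qpoly n x + \sum_(0 <= j < n) x ^+ j.
Proof.
rewrite -!Qpoly_polyE; apply/eqP; rewrite addrC -subr_eq -hornerN -hornerD.
rewrite Qpoly_poly_difference horner_sum; apply/eqP.
by apply: eq_bigr => j _; rewrite hornerXn.
Qed.

Lemma Qpoly0 (x : R) : Qpoly 0 x = 0.
Proof. by rewrite /Qpoly big_geq. Qed.

(** The Taylor expansion of ['X^n] at 1 with its remainder: this ties the growth
    of [Qpoly n] to that of the powers. *)
Lemma expr_QpolyE n (x : R) :
  x ^+ n = 1 + n%:R * (x - 1) + (x - 1) ^+ 2 * Qpoly n x.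
Proof.
elim: n => [|n IH]; first by rewrite Qpoly0 expr0; ring.
rewrite Qpoly_recr big_mkord (mulrDr ((x - 1) ^+ 2)) (expr2 (x - 1)).
rewrite -[in X in _ + (_ + X)]mulrA -subrX1 exprS -natr1 IH; ring.
Qed.

Lemma Qpoly1_ge n : n%:R * (n%:R - 1) / 2 <= Qpoly n (1 : R).
Proof.
elim: n => [|n IH]; first by rewrite Qpoly0 !mul0r.
rewrite Qpoly_recr; under eq_bigr do rewrite expr1n.
by rewrite big_const_nat iter_addr_0 subn0 -natr1; lra.
Qed.

End QPolynomials.

Arguments Qpoly_poly {R} n.

(** * Integration over the support *)

Section Support.
Variable R : realType.
Variable nu : {finite_measure set (measurableTypeR R) -> \bar R}.

(** The complement of the support is covered by the countably many null
    intervals with rational endpoints. *)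
Lemma measure_above_support (t : R) :
  (forall x, measure_support nu x -> x <= t) -> nu `]t, +oo[%classic = 0%E.
Proof.
move=> supp_le.
pose null_itv (k : nat) : set R := if unpickle k is Some pq then
  let J := `](ratr pq.1 : R), (ratr pq.2 : R)[%classic in
  if nu J == 0%E then J else set0 else set0.
have neg_itv k : nu.-negligible (null_itv k).
  rewrite /null_itv; case: (unpickle k) => [[p q]|] /=; last exact: negligible_set0.
  case: ifPn => [/eqP J0|_]; last exact: negligible_set0.
  by apply/negligibleP => //; exact: measurable_itv.
apply/negligibleP; first exact: measurable_itv.
apply: negligibleS (negligible_bigcup neg_itv) => x /=.
rewrite in_itv /= andbT => tx.
have : ~ measure_support nu x by move=> /supp_le; rewrite leNgt tx.
move=> /existsNP[U /not_implyP[oU /not_implyP[Ux nuU]]].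
have [e e0 xeU] : exists2 e : R, 0 < e & ball x e `<=` U.
  by apply/nbhs_ballP; exact: open_nbhs_nbhs.
have xe : x - e < x by rewrite ltrBlDr ltrDl.
have xe' : x < x + e by rewrite ltrDl.
have [p] := rat_in_itvoo xe.
rewrite in_itv /= => /andP[ep px].
have [q] := rat_in_itvoo xe'.
rewrite in_itv /= => /andP[xq qe].
have [k kpq] : exists k, unpickle k = Some (p, q).
  by exists (pickle (p, q)); rewrite pickleK.
exists k => //; rewrite /null_itv kpq.
have -> : nu `](ratr p : R), (ratr q : R)[%classic = 0%E.
  apply/eqP; rewrite eq_le measure_ge0 andbT leNgt; apply/negP => J0; apply: nuU.
  apply: lt_le_trans J0 _; apply: le_measure; rewrite ?inE.
  - exact: measurable_itv.
  - exact: open_measurable.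
  - move=> y /=; rewrite in_itv /= => /andP[py yq]; apply: xeU.
    by rewrite /ball /= ltr_norml; lra.
by rewrite /= eqxx /= in_itv /= px xq.
Qed.

Lemma atom_in_support (t : R) : (0 < nu [set t])%E -> measure_support nu t.
Proof.
move=> t0 U oU Ut; apply: lt_le_trans t0 _; apply: le_measure; rewrite ?inE.
- exact: measurable_set1.
- exact: open_measurable.
- by move=> _ ->.
Qed.

End Support.

(** Finitely many positive ratios [u n / v n] have a positive minimum. *)
Lemma eventual_lower_bound (R : realFieldType) (u v : nat -> R) (e : R) N :
  (forall n, 0 < u n) -> (forall n, 0 < v n) -> 0 < e ->
  (forall n, (N <= n)%N -> e * v n <= u n) ->
  exists2 m, 0 < m & forall n, m * v n <= u n.
Proof.
move=> u0 v0; elim: N e => [|N IH] e e0 low; first by exists e => // n; exact: low.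
apply: (IH (Num.min e (u N / v N))) => [|n]; first by rewrite lt_min e0 divr_gt0.
rewrite leq_eqVlt => /predU1P[<-|/low le_n].
  by rewrite -ler_pdivlMr// ge_min lexx orbT.
by apply: le_trans le_n; rewrite ler_wpM2r ?ge_min ?lexx// ltW.
Qed.

Section IntegralOnSupport.
Variable R : realType.
Variable nu : {finite_measure set (measurableTypeR R) -> \bar R}.
Variable theta : R.
Hypothesis theta1 : 1 < theta.
Hypothesis nu1 : nu [set 1] = 0%E.
Hypothesis nu_above : nu `]theta, +oo[%classic = 0%E.

Implicit Types (x : R) (p q : {poly R}).

(** The half-line and [E] differ by a [nu]-null set.  The point 1 is left out so
    that the functions [(x - 1)^-1] and [(x - 1)^-2] are limits of polynomials
    everywhere on [E]. *)
Let E : set (measurableTypeR R) := `[0, 1[%classic `|` `]1, theta]%classic.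

Let mE : measurable E.
Proof. by apply: measurableU; exact: measurable_itv. Qed.

Lemma mem_support_itv (x : R) : E x -> [/\ 0 <= x, x <= theta & x != 1].
Proof.
rewrite /E /= !in_itv /= => -[|] /andP[h1 h2]; split => //.
- exact: ltW (lt_trans h2 theta1).
- by rewrite lt_eqF.
- exact: ltW (lt_trans ltr01 h1).
- by rewrite gt_eqF.
Qed.

Lemma disjoint_support_itv :
  [disjoint `[0%R, 1%R[%classic & `]1%R, theta]%classic].
Proof.
apply/disj_setPS => x [] /=; rewrite !in_itv /= => /andP[_ x1] /andP[x1' _].
by have := lt_trans x1 x1'; rewrite ltxx.
Qed.

Lemma integral_half_line (f : measurableTypeR R -> \bar R) :
  measurable_fun [set: measurableTypeR R] f ->
  (\int[nu]_(x in `[0%R, +oo[) f x = \int[nu]_(x in E) f x)%E.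
Proof.
move=> mf; pose N : set (measurableTypeR R) := [set 1] `|` `]theta, +oo[%classic.
have mN : measurable N.
  by apply: measurableU; [exact: measurable_set1|exact: measurable_itv].
have N0 : nu N = 0%E by rewrite null_set_setU//; exact: measurable_itv.
have -> : E = `[0%R, +oo[%classic `\` N.
  apply/seteqP; split => x; rewrite /E /N /= !in_itv /= ?andbT.
    move=> Ex; have [x0 xt x1] : [/\ 0 <= x, x <= theta & x != 1].
      by apply: mem_support_itv; rewrite /E /= !in_itv.
    by split=> // -[/eqP|]; [exact/negP|rewrite ltNge xt].
  move=> [x0 /not_orP[/eqP x1 /negP]]; rewrite -leNgt => xt.
  by move: x1; rewrite neq_lt x0 xt andbT => /orP[->|->]; [left|right].
rewrite integralE [RHS]integralE; congr (_ - _)%E;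
  apply: ge0_negligible_integral => //; try exact: measurable_itv.
- exact/measurable_funepos/measurable_funTS.
- exact/measurable_funeneg/measurable_funTS.
Qed.

Lemma measurable_horner (p : {poly R}) :
  measurable_fun [set: measurableTypeR R] (fun x : measurableTypeR R => p.[x]).
Proof. by apply: continuous_measurable_fun; exact: continuous_horner. Qed.

Lemma horner_bounded (p : {poly R}) :
  exists M, forall x, E x -> `|p.[x]| <= M.
Proof.
elim/poly_ind: p => [|p k [M bM]]; first by exists 0 => x _; rewrite horner0 normr0.
exists (M * theta + `|k|) => x Ex; rewrite hornerMXaddC.
apply: le_trans (ler_normD _ _) _; rewrite lerD2r normrM.
have [x0 xt _] := mem_support_itv Ex.
by rewrite ler_pM// ?bM// ger0_norm.
Qed.

Lemma integrable_horner (p : {poly R}) :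
  nu.-integrable E (fun x => (p.[x])%:E).
Proof.
apply: measurable_bounded_integrable => //.
- by rewrite -ge0_fin_numE ?fin_num_measure.
- by apply: measurable_funTS; exact: measurable_horner.
- have [M bM] := horner_bounded p; exists M; split; first exact: num_real.
  by move=> y My x /bM /le_trans; apply; exact: ltW.
Qed.

Definition poly_integral (p : {poly R}) : R := \int[nu]_(x in E) p.[x].
Local Notation I := poly_integral.

Lemma poly_integralE p : (I p)%:E = (\int[nu]_(x in E) (p.[x])%:E)%E.
Proof.
rewrite /I /Rintegral fineK//.
exact: integrable_fin_num (integrable_horner p).
Qed.

Lemma poly_integral_is_linear : linear_for *%R I.
Proof.
move=> k p q.
have ikp : nu.-integrable E (EFin \o (fun x => k * p.[x])).
  have := integrable_horner (k *: p); apply: eq_integrable => // x _ /=.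
  by rewrite hornerZ.
rewrite /I -RintegralZl//; last exact: integrable_horner.
rewrite -RintegralD//; last exact: integrable_horner.
by apply: eq_Rintegral => x _; rewrite hornerD hornerZ.
Qed.

HB.instance Definition _ :=
  GRing.isLinear.Build R {poly R} R _ poly_integral poly_integral_is_linear.

Lemma poly_integralZ k p : I (k *: p) = k * I p.
Proof. by rewrite linearZ. Qed.

Lemma le_poly_integral p q : (forall x, E x -> p.[x] <= q.[x]) -> I p <= I q.
Proof. by move=> pq; apply: le_Rintegral => //; exact: integrable_horner. Qed.

Lemma moment_integral p : moment (fun n => I 'X^n) p = I p.
Proof.
rewrite -[in RHS](coefK p) poly_def linear_sum; apply: eq_bigr => i _.
by rewrite linearZ.
Qed.

Lemma poly_integral_dominated (P : nat -> {poly R}) (f g : measurableTypeR R -> R) :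
  measurable_fun [set: measurableTypeR R] f -> nu.-integrable E (EFin \o g) ->
  (forall x, E x -> (fun m => (P m).[x]) @ \oo --> f x) ->
  (forall m x, E x -> `|(P m).[x]| <= g x) ->
  nu.-integrable E (EFin \o f) /\
  (fun m => I (P m)) @ \oo --> \int[nu]_(x in E) f x.
Proof.
move=> mf ig Pf Pg.
have [|||//||intf _ cvgI] := @dominated_convergence _ _ R nu E mE
  (fun m x => ((P m).[x])%:E) (EFin \o f) (EFin \o g).
- move=> m; apply/measurable_EFinP; apply: measurable_funTS.
  exact: measurable_horner.
- exact/measurable_EFinP/measurable_funTS.
- by apply: aeW => x Ex; apply: cvg_EFin; [exact: nearW|exact: Pf].
- by apply: aeW => x m Ex; rewrite lee_fin; exact: Pg.
split=> //; apply: fine_cvg; rewrite fineK; last exact: integrable_fin_num.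
exact: cvgI.
Qed.

Lemma poly_integral_pow_cvg0 p (u : {poly R}) : (forall x, E x -> `|u.[x]| < 1) ->
  (fun m => I (p * u ^+ m)) @ \oo --> 0.
Proof.
move=> u1; have [M bM] := horner_bounded p.
have [||||_] := @poly_integral_dominated (fun m => p * u ^+ m) (fun=> 0) (fun=> M).
- exact: measurable_cst.
- have := integrable_horner M%:P; apply: eq_integrable => // x _ /=.
  by rewrite hornerC.
- move=> x Ex; under eq_fun do rewrite hornerM horner_exp.
  rewrite -(mulr0 p.[x]); apply: cvgM; first exact: cvg_cst.
  exact: cvg_expr (u1 _ Ex).
- move=> m x Ex; rewrite hornerM horner_exp normrM normrX.
  rewrite -[leRHS]mulr1 ler_pM ?exprn_ge0 ?bM//.
  by rewrite exprn_ile1// ltW// u1.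
- by rewrite Rintegral_cst// mul0r.
Qed.

Lemma hornerXsub1 x : ('X - 1 : {poly R}).[x] = x - 1.
Proof. by rewrite !hornerE. Qed.

(** The width [theta] is chosen because [E] is contained in the points at
    distance at most [theta] from 1: there the polynomial is nonnegative and it
    reaches the value 1 at the point 1 only, so that its powers single out that
    point. *)
Definition bump : {poly R} := 1 - (theta ^- 2) *: ('X - 1) ^+ 2.

Lemma bumpE x : bump.[x] = 1 - ((x - 1) / theta) ^+ 2.
Proof.
rewrite /bump !hornerE /=; field.
by rewrite gt_eqF// (lt_trans ltr01 theta1).
Qed.

Lemma bump_itv x : E x -> 0 <= bump.[x] < 1.
Proof.
move=> /mem_support_itv[x0 xt x1]; rewrite bumpE.
have t1 := theta1; have t0 : 0 < theta := lt_trans ltr01 theta1.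
have z : (x - 1) / theta != 0.
  by apply: mulf_neq0; [rewrite subr_eq0|rewrite invr_eq0 gt_eqF].
have : 0 < ((x - 1) / theta) ^+ 2 by rewrite exprn_even_gt0.
have : `|(x - 1) / theta| <= 1.
  rewrite normrM normfV (gtr0_norm t0) ler_pdivrMr// mul1r ler_norml.
  by apply/andP; split; lra.
rewrite ler_norml => /andP[]; set y := (x - 1) / theta => ym yM y2.
by apply/andP; split; nra.
Qed.

(** A geometric sum: it is [1 - bump ^+ m] divided by [('X - 1) ^+ 2], and on [E]
    it increases to [(x - 1)^-2] as [m] grows. *)
Definition bump_quotient m : {poly R} := (theta ^- 2) *: \sum_(k < m) bump ^+ k.

Lemma bump_quotientE m : ('X - 1) ^+ 2 * bump_quotient m = 1 - bump ^+ m.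
Proof.
rewrite /bump_quotient -scalerAr scalerAl.
have -> : theta ^- 2 *: ('X - 1) ^+ 2 = 1 - bump by rewrite /bump; ring.
by rewrite -[RHS]opprB subrX1 -[RHS]mulNr [in RHS]opprB.
Qed.

Lemma horner_bump_quotientE m x :
  (x - 1) ^+ 2 * (bump_quotient m).[x] = 1 - bump.[x] ^+ m.
Proof.
have := congr1 (horner^~ x) (bump_quotientE m).
by rewrite hornerM hornerD hornerN !horner_exp hornerXsub1 -polyC1 hornerC.
Qed.

Lemma horner_bump_quotient m x : E x ->
  (bump_quotient m).[x] = (1 - bump.[x] ^+ m) / (x - 1) ^+ 2.
Proof.
move=> /mem_support_itv[_ _ x1]; rewrite -horner_bump_quotientE.
by field; rewrite subr_eq0.
Qed.

Lemma bump_quotient_ge0 m x : E x -> 0 <= (bump_quotient m).[x].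
Proof.
move=> Ex; have /andP[b0 b1] := bump_itv Ex.
by rewrite horner_bump_quotient// divr_ge0 ?sqr_ge0// subr_ge0 exprn_ile1// ltW.
Qed.

Lemma bump_quotient_nondecreasing x : E x ->
  {homo (fun m => (bump_quotient m).[x]) : m n / (m <= n)%N >-> m <= n}.
Proof.
move=> Ex m n mn; have /andP[b0 b1] := bump_itv Ex.
rewrite !horner_bump_quotient// ler_wpM2r ?invr_ge0 ?sqr_ge0//.
by rewrite lerB// ler_wiXn2l// ltW.
Qed.

Lemma bump_quotient_le m x : E x -> (bump_quotient m).[x] <= ((x - 1) ^+ 2)^-1.
Proof.
move=> Ex; have /andP[b0 b1] := bump_itv Ex.
by rewrite horner_bump_quotient// ler_piMl ?invr_ge0 ?sqr_ge0// gerBl exprn_ge0.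
Qed.

Lemma bump_quotient_cvg x : E x ->
  (fun m => (bump_quotient m).[x]) @ \oo --> ((x - 1) ^+ 2)^-1.
Proof.
move=> Ex; have /andP[b0 b1] := bump_itv Ex.
have : (fun m => (1 - bump.[x] ^+ m) * ((x - 1) ^+ 2)^-1) @ \oo -->
    (1 - 0) * ((x - 1) ^+ 2)^-1.
  apply: cvgM; [apply: cvgB; [exact: cvg_cst|]|exact: cvg_cst].
  by apply: cvg_expr; rewrite ger0_norm.
by rewrite subr0 mul1r; under eq_fun do rewrite -horner_bump_quotient//.
Qed.


(** [Qpoly n] is nondecreasing on the half-line, hence largest on [E] at [theta];
    keeping only the atom gives the bound from below. *)
Lemma poly_integral_Qpoly_le n :
  I (Qpoly_poly n) <= Qpoly n theta * fine (nu E).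
Proof.
have -> : Qpoly n theta * fine (nu E) = I (Qpoly n theta)%:P.
  rewrite -Rintegral_cst//; apply: eq_Rintegral => x _.
  by rewrite hornerC.
apply: le_poly_integral => x /mem_support_itv[x0 xt _].
by rewrite hornerC Qpoly_polyE Qpoly_le.
Qed.

Lemma poly_integral_Qpoly_ge n :
  Qpoly n theta * fine (nu [set theta]) <= I (Qpoly_poly n).
Proof.
have m1 : measurable [set theta : measurableTypeR R] by exact: measurable_set1.
rewrite -lee_fin EFinM fineK ?fin_num_measure// poly_integralE.
have -> : ((Qpoly n theta)%:E * nu [set theta] =
    \int[nu]_(x in [set theta]) ((Qpoly_poly n).[x])%:E)%E.
  rewrite -integral_cst//; apply: eq_integral => x; rewrite inE => -> /=.
  by rewrite Qpoly_polyE.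
apply: ge0_subset_integral => //.
- by apply/measurable_EFinP; apply: measurable_funTS; exact: measurable_horner.
- move=> x /mem_support_itv[x0 _ _].
  by rewrite lee_fin Qpoly_polyE Qpoly_ge0.
- by move=> x ->; right; rewrite /= in_itv /= theta1 lexx.
Qed.

Section MomentSequence.
Variables (gam : nat -> R) (b c : R).
Hypothesis gamE : forall n,
  gam n = 1 + b * n%:R + c * n%:R ^+ 2 + I (Qpoly_poly n).

(** The constants in the second difference of [gam] come from [c * n ^+ 2]
    alone, whose second difference is [2 * c]. *)
Lemma moment_twisted q : moment gam (('X - 1) ^+ 2 * q) = 2 * c * q.[1] + I q.
Proof.
rewrite moment_second_difference -moment_integral -moment_powers -moment_combination.
congr moment; apply/funext => n.
rewrite -Qpoly_poly_second_difference (linearD poly_integral).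
rewrite (linearB poly_integral) /= poly_integralZ /= !gamE expr1n.
by rewrite -!natr1; ring.
Qed.

(** By Taylor expansion [theta ^+ n] is [d ^+ 2 * Qpoly n theta] up to an affine
    term in [n], and [Qpoly n theta] is at least quadratic in [n].  Hence the
    atom alone makes [gam n] comparable with [theta ^+ n]. *)
Lemma growth_bounds : 0 <= c -> (0 < nu [set theta])%E -> (forall n, 0 < gam n) ->
  exists m C : R, 0 < m /\ forall n, m * theta ^+ n <= gam n <= C * theta ^+ n.
Proof.
move=> c0 atom gam0; set K := fine (nu E); set mu := fine (nu [set theta]).
have mu0 : 0 < mu by rewrite fine_gt0// atom -ge0_fin_numE ?fin_num_measure.
have K0 : 0 <= K by exact: fine_ge0.
have t1 := theta1; pose d := theta - 1.
have d0 : 0 < d by rewrite subr_gt0.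
have pow n : theta ^+ n = 1 + n%:R * d + d ^+ 2 * Qpoly n theta.
  exact: expr_QpolyE.
have Qlow n : n%:R * (n%:R - 1) / 2 <= Qpoly n theta.
  by apply: le_trans (Qpoly1_ge R n) _; rewrite Qpoly_le// ltW.
have t0 : 0 < theta by apply: lt_trans ltr01 t1.
have Q0 n : 0 <= Qpoly n theta by rewrite Qpoly_ge0// ltW.
have n0 n : 0 <= n%:R :> R by exact: ler0n.
pose C := 1 + `|b| / d + c * (2 / d ^+ 2 + d^-1) + K / d ^+ 2.
have upper n : gam n <= C * theta ^+ n.
  rewrite gamE; set T := theta ^+ n.
  have T1 : 1 <= T by rewrite /T exprn_ege1// ltW.
  have Tn : n%:R <= T / d.
    rewrite ler_pdivlMr// /T pow; have := mulr_ge0 (sqr_ge0 d) (Q0 n); lra.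
  have TQ : Qpoly n theta <= T / d ^+ 2.
    rewrite ler_pdivlMr ?exprn_gt0// /T pow [leLHS]mulrC.
    by have := mulr_ge0 (n0 n) (ltW d0); lra.
  have Tnn : n%:R ^+ 2 <= T * (2 / d ^+ 2 + d^-1).
    have -> : T * (2 / d ^+ 2 + d^-1) = 2 * (T / d ^+ 2) + T / d by ring.
    by have := Qlow n; rewrite expr2; lra.
  have IQ : I (Qpoly_poly n) <= (T / d ^+ 2) * K.
    by apply: le_trans (poly_integral_Qpoly_le n) _; rewrite ler_wpM2r.
  have bn : b * n%:R <= `|b| * (T / d).
    by apply: le_trans (ler_wpM2r (n0 n) (ler_norm b)) _; rewrite ler_wpM2l.
  have cn := ler_wpM2l c0 Tnn.
  have -> : C * T = T + `|b| * (T / d) + c * (T * (2 / d ^+ 2 + d^-1))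
     + T / d ^+ 2 * K by rewrite /C; ring.
  by rewrite !lerD.
(* This constant spends one half of the contribution of the atom on the
   exponential; the other half, quadratic in [n], absorbs the affine terms. *)
pose e := mu / (2 * d ^+ 2).
have e0 : 0 < e by rewrite divr_gt0// mulr_gt0// exprn_gt0.
pose L := `|b| + e + e * d.
have [N lowN] : exists N, forall n, (N <= n)%N -> e * theta ^+ n <= gam n.
  exists (Num.truncn (4 * L / mu)).+2 => n Nn.
  have nL : 4 * L / mu <= n%:R - 1.
    have : (Num.truncn (4 * L / mu)).+1%:R <= n%:R - 1 :> R.
      by rewrite lerBrDr natr1 ler_nat.
    exact/le_trans/ltW/truncnS_gt.
  have n1 : 1 <= n%:R :> R by rewrite ler1n (leq_trans _ Nn).
  rewrite ler_pdivrMr// in nL.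
  have e2 : e * (d ^+ 2 * Qpoly n theta) = mu / 2 * Qpoly n theta.
    by rewrite /e; field; rewrite gt_eqF.
  rewrite gamE pow (mulrDr e) e2.
  have IQ := poly_integral_Qpoly_ge n; rewrite -/mu in IQ.
  have cn : 0 <= c * n%:R ^+ 2 by rewrite mulr_ge0 ?sqr_ge0.
  have bn : - (`|b| * n%:R) <= b * n%:R.
    by rewrite -mulNr ler_wpM2r// lerNl -normrN ler_norm.
  have quad : L * n%:R <= mu / 2 * Qpoly n theta.
    have := ler_wpM2l (ltW mu0) (Qlow n); have := ler_wpM2r (n0 n) nL; lra.
  have : e + e * (n%:R * d) <= (e + e * d) * n%:R.
    have := ler_wpM2l (ltW e0) n1; lra.
  rewrite /L in quad; lra.
suff [m m0 low] : exists2 m, 0 < m & forall n, m * theta ^+ n <= gam n.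
  by exists m, C; split=> // n; rewrite low upper.
by apply: (eventual_lower_bound gam0 _ e0 lowN) => n; rewrite exprn_gt0.
Qed.

Hypothesis gam_psd : forall n (a : nat -> R),
  0 <= \sum_(i < n) \sum_(j < n) a i * a j * gam (i + j)%N.

(** This is the positivity of the moment functional at the square of
    [1 - ('X - 1) * (a + ('X - 1) * s)].  Splitting off the value [a] at 1 writes
    the cross term as a multiple of [('X - 1) ^+ 2], so that the measure
    represents it. *)
Lemma test_inequality a s :
  0 <= 1 - 2 * a * (b + c) + 2 * c * a ^+ 2 - 4 * c * s.[1] - 2 * I s
       + I ((a%:P + ('X - 1) * s) ^+ 2).
Proof.
have Q01 : (Qpoly_poly 0 : {poly R}) = 0 /\ (Qpoly_poly 1 : {poly R}) = 0.
  by rewrite /Qpoly_poly big_geq// big_nat1 scale0r.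
have gam0 : gam 0%N = 1 by rewrite gamE Q01.1 linear0; ring.
have gam1 : gam 1%N = 1 + b + c by rewrite gamE Q01.2 linear0; ring.
have momX : moment gam 'X = gam 1%N by rewrite -['X]expr1 moment_Xn.
set q := a%:P + ('X - 1) * s.
have q1 : q.[1] = a.
  by rewrite hornerD hornerM hornerXsub1 hornerC subrr mul0r addr0.
set P := 1 - ('X - 1) * q.
have : 0 <= moment gam (P * P) by rewrite moment_mul; exact: gam_psd.
have -> : P * P = 1 - (2 * a) *: ('X - 1) - 2 *: (('X - 1) ^+ 2 * s)
                    + ('X - 1) ^+ 2 * q ^+ 2.
  by rewrite /P /q -!mul_polyC; rewrite polyCM; ring.
rewrite momentD !momentB !momentZ momentB !moment_twisted moment1.
rewrite momX gam0 gam1 horner_exp q1; congr (_ <= _); ring.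
Qed.

Lemma bump1 m : (bump ^+ m).[1] = 1.
Proof. by rewrite horner_exp bumpE subrr mul0r expr0n subr0 expr1n. Qed.

Lemma bump_pow_cvg0 p : (fun m => I (p * bump ^+ m)) @ \oo --> 0.
Proof.
by apply: poly_integral_pow_cvg0 => x /bump_itv/andP[b0 b1]; rewrite ger0_norm.
Qed.

Lemma bump_sqr_pow_cvg0 p : (fun m => I (p * (bump ^+ 2) ^+ m)) @ \oo --> 0.
Proof.
apply: poly_integral_pow_cvg0 => x /bump_itv/andP[b0 b1].
by rewrite horner_exp normrX exprn_ilt1// ger0_norm.
Qed.

(** With [a = 0] and [s] a multiple of a power of the bump, both integrals tend
    to 0 while [s.[1]] does not move; what remains is affine in the multiple. *)
Lemma quadratic_coef_eq0 : c = 0.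
Proof.
apply/eqP/negP => /negP c0.
pose f m := 1 - 4 * c * c^-1 - 2 * c^-1 * I (1 * bump ^+ m)
   + c^-1 ^+ 2 * I (('X - 1) ^+ 2 * (bump ^+ 2) ^+ m).
have f0 m : 0 <= f m.
  have := test_inequality 0 (c^-1 *: bump ^+ m).
  have -> : (0%:P + ('X - 1) * (c^-1 *: bump ^+ m)) ^+ 2 =
      c^-1 ^+ 2 *: (('X - 1) ^+ 2 * (bump ^+ 2) ^+ m).
    by rewrite add0r -scalerAr exprZn exprMn -!exprM mulnC.
  rewrite !poly_integralZ hornerZ bump1 /f mul1r.
  by congr (_ <= _); ring.
have cf : f @ \oo --> 1 - 4 * c * c^-1 - 2 * c^-1 * 0 + c^-1 ^+ 2 * 0.
  by apply: cvgD; [apply: cvgB; [exact: cvg_cst|]|]; apply: cvgM;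
    [exact: cvg_cst|exact: bump_pow_cvg0|exact: cvg_cst|exact: bump_sqr_pow_cvg0].
have : 0 <= limn f.
  by apply: limr_ge; [apply/cvg_ex; eexists; exact: cf|exact: nearW].
rewrite (cvg_lim _ cf)//; have -> : 4 * c * c^-1 = 4 by rewrite -mulrA divff// mulr1.
lra.
Qed.

(** With [a = 0] and [s = bump_quotient m] the square is dominated by [s], so the
    test inequality reduces to [0 <= 1 - I s]. *)
Lemma integral_bump_quotient_le1 m : I (bump_quotient m) <= 1.
Proof.
have := test_inequality 0 (bump_quotient m); rewrite quadratic_coef_eq0.
set J := I ((_ + _) ^+ 2) => h.
have : J <= I (bump_quotient m).
  apply: le_poly_integral => x Ex.
  have -> : ((0%:P + ('X - 1) * bump_quotient m) ^+ 2).[x] =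
      (1 - bump.[x] ^+ m) * (bump_quotient m).[x].
    rewrite horner_exp hornerD hornerM hornerXsub1 hornerC add0r.
    by rewrite -horner_bump_quotientE; ring.
  have /andP[b0 b1] := bump_itv Ex.
  by rewrite ler_piMl ?bump_quotient_ge0// gerBl exprn_ge0.
lra.
Qed.

Local Notation inv_sqr := (fun x : measurableTypeR R => ((x - 1) ^+ 2)^-1).

Lemma integral_inv_sqr_le1 : (\int[nu]_(x in E) (inv_sqr x)%:E <= 1)%E.
Proof.
have -> : (\int[nu]_(x in E) (inv_sqr x)%:E =
    \int[nu]_(x in E) limn (fun m => ((bump_quotient m).[x])%:E))%E.
  apply: eq_integral => x; rewrite inE => Ex; apply/esym/cvg_lim => //.
  by apply: cvg_EFin; [exact: nearW|exact: bump_quotient_cvg].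
rewrite monotone_convergence//; last 3 first.
- move=> m; apply/measurable_EFinP; apply: measurable_funTS.
  exact: measurable_horner.
- by move=> m x Ex; rewrite lee_fin bump_quotient_ge0.
- by move=> x Ex m n mn; rewrite lee_fin bump_quotient_nondecreasing.
apply: lime_le.
  apply: ereal_nondecreasing_is_cvgn => m n mn; rewrite -!poly_integralE lee_fin.
  by apply: le_poly_integral => x Ex; rewrite bump_quotient_nondecreasing.
apply: nearW => m; rewrite -poly_integralE lee_fin.
exact: integral_bump_quotient_le1.
Qed.

Lemma measurable_inv1 : measurable_fun [set: measurableTypeR R]
  (fun x : measurableTypeR R => (x - 1)^-1).
Proof.
have -> : [set: measurableTypeR R] = [set 1] `|` ~` [set 1] by rewrite setUv.
apply/measurable_funU; [exact: measurable_set1| |split].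
- by apply: measurableC; exact: measurable_set1.
- exact: measurable_fun_set1.
- apply: open_continuous_measurable_fun.
    by rewrite openC; exact: closed_eq.
  move=> x; rewrite inE /= => /eqP x1.
  apply: (@continuousV R R^o (fun y : R => y - 1) x); first by rewrite subr_eq0.
  by apply: cvgB; [exact: cvg_id|exact: cvg_cst].
Qed.

Lemma measurable_inv_sqr : measurable_fun [set: measurableTypeR R] inv_sqr.
Proof.
under eq_fun do rewrite -exprVn.
by apply: measurable_funX; exact: measurable_inv1.
Qed.

Lemma integrable_inv_sqr : nu.-integrable E (EFin \o inv_sqr).
Proof.
apply/integrableP; split.
  by apply/measurable_EFinP; apply: measurable_funTS; exact: measurable_inv_sqr.
rewrite (eq_integral (EFin \o inv_sqr)).
  exact: le_lt_trans integral_inv_sqr_le1 (ltry 1).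
by move=> x _ /=; rewrite ger0_norm// invr_ge0 sqr_ge0.
Qed.

(** Here the polynomial [a + ('X - 1) * s] is [t] times a power of the bump.  In
    the limit the test inequality is affine in [t], hence has zero slope. *)
Lemma linear_coefE : (b%:E = \int[nu]_(x in E) ((x - 1)^-1)%:E)%E.
Proof.
pose J := \int[nu]_(x in E) (x - 1)^-1.
have [intJ cvgJ] : nu.-integrable E (EFin \o (fun x => (x - 1)^-1)) /\
    (fun m => I (('X - 1) * bump_quotient m)) @ \oo --> J.
  apply: (@poly_integral_dominated _ _ (fun x => 1 + inv_sqr x)).
  - exact: measurable_inv1.
  - have i1 : nu.-integrable E (EFin \o cst (1 : R)).
      have := integrable_horner 1; apply: eq_integrable => // x _ /=.
      by rewrite hornerC.
    have := integrableD mE i1 integrable_inv_sqr.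
    by apply: eq_integrable.
  - move=> x Ex; have [_ _ x1] := mem_support_itv Ex.
    have -> : (x - 1)^-1 = (x - 1) * ((x - 1) ^+ 2)^-1 by field; rewrite subr_eq0.
    under eq_fun do rewrite hornerM hornerXsub1.
    by apply: cvgM; [exact: cvg_cst|exact: bump_quotient_cvg].
  - move=> m x Ex; have [_ _ x1] := mem_support_itv Ex.
    rewrite hornerM hornerXsub1 normrM (ger0_norm (bump_quotient_ge0 m Ex)).
    apply: le_trans (ler_wpM2l _ (bump_quotient_le m Ex)) _ => //.
    rewrite -real_normK ?num_real//; set y := `|x - 1|.
    have y0 : 0 < y by rewrite normr_gt0 subr_eq0.
    have -> : y * (y ^+ 2)^-1 = y^-1 by field; rewrite gt_eqF.
    by rewrite -exprVn; have := sqr_ge0 (y^-1 - 1); nra.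
(* As [1 - bump ^+ m] is divisible by [('X - 1) ^+ 2], the polynomial
   [t *: bump ^+ m] has the form required by the test inequality. *)
have key t : 0 <= 1 - 2 * t * (b - J).
  pose f m := 1 - 2 * t * (b - I (('X - 1) * bump_quotient m))
    + t ^+ 2 * I (1 * (bump ^+ 2) ^+ m).
  have f0 m : 0 <= f m.
    have := test_inequality t (- t *: (('X - 1) * bump_quotient m)).
    have -> : (t%:P + ('X - 1) * (- t *: (('X - 1) * bump_quotient m))) ^+ 2 =
        t ^+ 2 *: (1 * (bump ^+ 2) ^+ m).
      have -> : ('X - 1) * (- t *: (('X - 1) * bump_quotient m)) =
          - t *: (('X - 1) ^+ 2 * bump_quotient m).
        by rewrite -scalerAr; congr (_ *: _); ring.
      rewrite bump_quotientE mul1r -exprM mulnC exprM -exprZn.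
      by congr (_ ^+ 2); rewrite -!mul_polyC polyCN; ring.
    rewrite !poly_integralZ quadratic_coef_eq0 /f.
    by congr (_ <= _); ring.
  have cf : f @ \oo --> 1 - 2 * t * (b - J) + t ^+ 2 * 0.
    apply: cvgD; [apply: cvgB; [exact: cvg_cst|]|]; apply: cvgM;
      [exact: cvg_cst| |exact: cvg_cst|exact: bump_sqr_pow_cvg0].
    by apply: cvgB; [exact: cvg_cst|exact: cvgJ].
  have : 0 <= limn f.
    by apply: limr_ge; [apply/cvg_ex; eexists; exact: cf|exact: nearW].
  by rewrite (cvg_lim _ cf)// mulr0 addr0.
suff -> : b = J by rewrite /J /Rintegral fineK//; exact: integrable_fin_num intJ.
apply/eqP; rewrite -subr_eq0; apply/negP => /negP bJ.
have := key (b - J)^-1; rewrite -mulrA mulVf//; lra.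
Qed.

End MomentSequence.

End IntegralOnSupport.

(** * Moments of a weighted shift *)

Section ShiftMoments.
Variable R : realType.

Lemma weighted_shift_iter (lambda : nat -> R) W n : is_weighted_shift lambda W ->
  iter n W (l2_basis R 0) = (\prod_(i < n) lambda i)%:C *: l2_basis R n.
Proof.
case=> _ _ We; elim: n => [|n IH]; first by rewrite big_ord0 scale1r.
by rewrite iterS IH linearZ We /= scalerA big_ord_recr rmorphM.
Qed.

Lemma weighted_shift_moments (lambda : nat -> R) W n : is_weighted_shift lambda W ->
  hnorm (iter n W (l2_basis R 0)) ^+ 2 = lambda_hat lambda n.
Proof.
move=> shiftW; rewrite (weighted_shift_iter _ shiftW) hnormZ hnorm_basis mulr1.
by rewrite normc_sqrE /= expr0n addr0 /lambda_hat -prodrXl.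
Qed.

End ShiftMoments.

Theorem theorem3p1p2 (R : realType) (lambda : nat -> R)
  (W : bounded_operator (l2 R) (l2 R))
  (b c : R) (nu : {finite_measure set (measurableTypeR R) -> \bar R})
  (theta : R)
  (hW : is_weighted_shift lambda W)
  (hcpd : conditionally_positive_definite W)
  (htriplet : is_scalar_representing_triplet lambda b c nu)
  (htheta : theta = sup (measure_support nu))
  (hi : 1 < theta)
  (hii : (\int[nu]_(x in `]1%R, theta]) (((x - 1) ^+ 2)^-1)%:E < +oo)%E)
  (hiii : (0 < nu [set theta])%E) :
  [/\ type_III c nu,
      exists (mu : nat -> R) (S : bounded_operator (l2 R) (l2 R)),
        [/\ is_weighted_shift mu S, subnormal S & similar_operators W S] &
      (1 - \int[nu]_(x in `]1%R, theta]) (((x - 1) ^+ 2)^-1)%:E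
         < \int[nu]_(x in `[0%R, 1%R[) (((x - 1) ^+ 2)^-1)%:E <= +oo)%E \/
      b%:E <> (\int[nu]_(x in `[0%R, +oo[) ((x - 1)^-1)%:E)%E \/
      0 < c ->
      ~ subnormal W].
Proof.
have [c0 nu_neg supp_compact nu1 repr] := htriplet.
have theta_max x : measure_support nu x -> x <= theta.
  have /compact_bounded[M [_ bM]] := supp_compact.
  rewrite htheta; apply: sup_ubound; exists (M + 1) => y /(bM (M + 1)) ylt.
  by apply: le_trans (ler_norm y) (ylt _); rewrite ltrDl.
have nu_above := measure_above_support theta_max.
have gamE n : lambda_hat lambda n =
    1 + b * n%:R + c * n%:R ^+ 2 + poly_integral nu theta (Qpoly_poly n).
  apply: EFin_inj; rewrite repr [in RHS]EFinD poly_integralE//; congr (_ + _)%E.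
  under [in RHS]eq_integral do rewrite Qpoly_polyE.
  apply: integral_half_line => //; apply/measurable_EFinP.
  rewrite (_ : Qpoly n = horner (Qpoly_poly n)); last first.
    by apply/funext => x; rewrite Qpoly_polyE.
  exact: measurable_horner.
have hat0 n : 0 < lambda_hat lambda n.
  by have [lam0 _ _] := hW; apply: prodr_gt0 => i _; rewrite exprn_gt0.
have theta0 : 0 < theta := lt_trans ltr01 hi.
split.
- by left => /(_ _ (atom_in_support hiii)) /= t0; move: theta0; rewrite t0 ltxx.
- have [m [C [m0 bounds]]] := growth_bounds hi gamE c0 hiii hat0.
  have r0 := sqrtr_ge0 theta.
  have r_gt0 : 0 < Num.sqrt theta by rewrite sqrtr_gt0.
  exists (fun=> Num.sqrt theta), (scaled_shift r0); split.
  + exact: scaled_shift_weighted.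
  + exact: scaled_shift_subnormal.
  + apply: (weighted_shift_similar r0 hW r_gt0 m0 (C := C)) => n.
    by rewrite -mul2n exprM sqr_sqrtr ?bounds// ltW.
- move=> conds subW.
  have psd n (a : nat -> R) :
      0 <= \sum_(i < n) \sum_(j < n) a i * a j * lambda_hat lambda (i + j).
    have := subnormal_orbit_psd (l2_basis R 0) subW n a.
    congr (_ <= _); apply: eq_bigr => i _; apply: eq_bigr => j _.
    by rewrite (weighted_shift_moments _ hW).
  case: conds => [/andP[+ _]|[|]].
  + have := integral_inv_sqr_le1 hi gamE psd.
    rewrite ge0_integral_setU; first last.
    - exact: disjoint_support_itv.
    - by move=> x _; rewrite lee_fin invr_ge0 sqr_ge0.
    - apply/measurable_EFinP; apply: measurable_funTS.
      exact: measurable_inv_sqr.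
    - exact: measurable_itv.
    - exact: measurable_itv.
    rewrite addeC => le1; rewrite lteBlDr; first by rewrite ltNge addeC le1.
    rewrite ge0_fin_numE//; apply: integral_ge0 => x _.
    by rewrite lee_fin invr_ge0 sqr_ge0.
  + apply; rewrite (linear_coefE hi gamE psd).
    rewrite (integral_half_line hi nu1 nu_above)//.
    by apply/measurable_EFinP; exact: measurable_inv1.
  + by rewrite (quadratic_coef_eq0 hi gamE psd) ltxx.
Qed.
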